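(* Let $n\ge 1$ and for $i,j,k\in[n]$ let $W_{i,j,k}=a_{i,j}+b_{i,k}+c_{j,k}$, where the $3n^2$ random variables $a_{i,j},b_{i,k},c_{j,k}$ ($i,j,k\in[n]$) are independent and uniform on $[0,1]$. Let \[ Z_n=\min\Big\{\sum_{i=1}^n W_{i,\sigma(i),\tau(i)} : \sigma,\tau \text{ permutations of } [n]\Big\}. \] Then there exist constants $c_1,c_2>0$ such that (a) $\mathbf{E}(Z_n)\ge c_1 n^{1/3}$, and (b) the algorithm GREEDY$(m)$ with $m=n-n^{1/4}$, with the final completion step made arbitrarily, outputs an assignment whose expected total cost is at most $c_2 n^{1/3}$.
   Context: The algorithm GREEDY$(m)$: set $B:=C:=[n]$ and $T:=\emptyset$. For $i=1,\dots,m$: choose $(j,k)$ with $j\in B$, $k\in C$ minimizing $W_{i,j,k}$ over $j\in B,k\in C$; add $(i,j,k)$ to $T$ and remove $j$ from $B$ and $k$ from $C$. Finally, complete the partial assignment $T$ to a full assignment (i.e. permutations $\sigma,\tau$ with $\sigma(i)=j,\tau(i)=k$ for $(i,j,k)\in T$) using any one of the remaining $((n-m)!)^2$ possibilities; the cost of the output is $\sum_{i=1}^n W_{i,\sigma(i),\tau(i)}$. *)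

(* Defs.v *)
From HB Require Import structures.
From mathcomp Require Import all_boot all_order all_algebra all_fingroup.
From mathcomp Require Import all_classical all_reals all_analysis.

Set Implicit Arguments.
Unset Strict Implicit.
Unset Printing Implicit Defensive.

Import Order.TTheory GRing.Theory Num.Theory.
Import numFieldNormedType.Exports.

Local Open Scope classical_set_scope.
Local Open Scope ring_scope.

Definition mutually_independent (d : measure_display) (T : measurableType d)
    (R : realType) (P : probability T R) (I : finType)
    (X : I -> {RV P >-> R}) : Prop :=
  forall (J : {set I}) (A : I -> set R),
    (forall i, i \in J -> measurable (A i)) ->
    P (\bigcap_(i in [set` J]) (X i @^-1` A i)) =
      (\prod_(i in J) P (X i @^-1` A i))%E.

(* The laws are compared on measurable sets only: the values of a measure of
   the library outside the sigma-algebra carry no information. *)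
Definition uniform01 (d : measure_display) (T : measurableType d)
    (R : realType) (P : probability T R) (X : {RV P >-> R}) : Prop :=
  forall A : set R, measurable A ->
    distribution P X A = uniform_prob (@ltr01 R) A.

(* The three n x n arrays as a single family indexed by a disjoint union. *)
Definition joint_family (U : Type) (n : nat) (a b c : 'I_n -> 'I_n -> U)
    (x : ('I_n * 'I_n) + ('I_n * 'I_n) + ('I_n * 'I_n)) : U :=
  match x with
  | inl (inl p) => a p.1 p.2
  | inl (inr p) => b p.1 p.2
  | inr p => c p.1 p.2
  end.

Definition weight (T : Type) (R : realType) (n : nat)
    (a b c : 'I_n -> 'I_n -> T -> R) (w : T) (i j k : 'I_n) : R :=
  a i j w + b i k w + c j k w.

Definition assignment_cost (R : realType) (n : nat)
    (W : 'I_n -> 'I_n -> 'I_n -> R) (sigma tau : 'S_n) : R :=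
  \sum_(i < n) W i (sigma i) (tau i).

(* The default value of the iterated minimum is itself one of the costs (that
   of the pair of identity permutations), so this is the minimum over all
   pairs. *)
Definition min_cost (R : realType) (n : nat)
    (W : 'I_n -> 'I_n -> 'I_n -> R) : R :=
  \big[Num.min/assignment_cost W 1%g 1%g]_(st : 'S_n * 'S_n)
    assignment_cost W st.1 st.2.

(* [greedy_run W m B C S]: after its first [m] iterations (rows 0, ..., m-1)
   the greedy algorithm can be in the state [(B, C, S)], where [S] is the
   partial assignment.  A relation, because the minimiser need not be unique. *)
Inductive greedy_run (R : realType) (n : nat)
    (W : 'I_n -> 'I_n -> 'I_n -> R) :
    nat -> {set 'I_n} -> {set 'I_n} -> {set 'I_n * 'I_n * 'I_n} -> Prop :=
| greedy_init : greedy_run W 0 [set: 'I_n]%SET [set: 'I_n]%SET finset.set0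
| greedy_step (i : 'I_n) (B C : {set 'I_n}) (S : {set 'I_n * 'I_n * 'I_n})
    (j k : 'I_n) :
    greedy_run W i B C S ->
    j \in B -> k \in C ->
    (forall j' k', j' \in B -> k' \in C -> W i j k <= W i j' k') ->
    greedy_run W i.+1 (B :\ j)%SET (C :\ k)%SET ((i, j, k) |: S)%SET.

Definition greedy_output (R : realType) (n : nat)
    (W : 'I_n -> 'I_n -> 'I_n -> R) (m : nat) (sigma tau : 'S_n) : Prop :=
  exists (B C : {set 'I_n}) (S : {set 'I_n * 'I_n * 'I_n}),
    greedy_run W m B C S /\
    forall i j k, (i, j, k) \in S -> sigma i = j /\ tau i = k.

Definition random_perm (d : measure_display) (T : measurableType d) (n : nat)
    (sigma : T -> 'S_n) : Prop :=
  forall s : 'S_n, measurable (sigma @^-1` [set s]).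

(* Main.v *)
(* Lower bound: for a fixed row i some pair (j, k) has a_ij, b_ik, c_jk <= x with
   probability at most n^2 x^3; at x of order n^(-2/3) this is 1/8, so every row
   costs at least a constant times n^(-2/3) in expectation.

   Upper bound: let r rows remain, r = n - i > n^(1/4), and let q be of order
   r^(1/3).  The sets B and C depend on the rows before i and on c, but not on
   row i of a and b.  A union bound over pairs of sets of size q^3 shows that,
   outside an event of probability 1/q^2, the graph of the entries
   c_jk <= 4/q^2 has at least q^4 edges in every q^3 x q^3 rectangle; it then
   has a subgraph in B x C with at least q^4 edges and all degrees at most q.
   Conditionally on the past, the second moment method for the number of its
   edges (j, k) with a_ij, b_ik <= l/q^2 bounds the probability of having none
   by 3/l^2, and summing over l gives an expected step cost of order
   q^(-2), i.e. r^(-2/3).  These sum to order n^(1/3), and the at most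
   n^(1/4) + 1 remaining rows cost at most 3 each.

   Ties could make the run depend on row i, but they have probability zero. *)
Require Import Defs.
From HB Require Import structures.
From mathcomp Require Import all_boot all_order all_algebra all_fingroup.
From mathcomp Require Import all_classical all_reals all_analysis.
From mathcomp Require Import measurable_realfun zify ring lra.

Set Implicit Arguments.
Unset Strict Implicit.
Unset Printing Implicit Defensive.

Import Order.TTheory GRing.Theory Num.Theory.
Import numFieldNormedType.Exports.

Local Open Scope classical_set_scope.
Local Open Scope ring_scope.

(** * Expectation of bounded functions *)

Section expectation_of_bounded_functions.
Context (d : measure_display) (T : measurableType d) (R : realType).
Variable P : probability T R.

(** Bounded measurable functions are integrable under a probability, so inside this class the
    real-valued expectation is linear and monotone without finiteness side conditions. *)
Definition bounded_meas (f : T -> R) : Prop :=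
  measurable_fun [set: T] f /\ exists M, forall w, `|f w| <= M.

Definition Ex (f : T -> R) : R := \int[P]_w f w.

Definition Pr (A : set T) : R := fine (P A).

Lemma Pr_EFin A : measurable A -> P A = (Pr A)%:E.
Proof. by move=> mA; rewrite /Pr fineK// fin_num_measure. Qed.

Lemma Pr_ge0 A : 0 <= Pr A.
Proof. exact: fine_ge0. Qed.

Lemma Pr_setT : Pr setT = 1.
Proof. by rewrite /Pr probability_setT. Qed.

Lemma bm_integrable f : bounded_meas f -> P.-integrable setT (EFin \o f).
Proof.
move=> [mf [M Mf]]; apply: measurable_bounded_integrable => //.
  by rewrite (le_lt_trans (probability_le1 P _))// ltry.
exists M; split; first exact: num_real.
by move=> y My w _; apply: (le_trans (Mf w)); apply: ltW.
Qed.

Lemma bm_cst r : bounded_meas (fun=> r).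
Proof. by split; [exact: measurable_cst|exists `|r|]. Qed.

Lemma bmD f g : bounded_meas f -> bounded_meas g ->
  bounded_meas (fun w => f w + g w).
Proof.
move=> [mf [M Mf]] [mg [N Ng]]; split; first exact: measurable_funD.
by exists (M + N) => w; rewrite (le_trans (ler_normD _ _))// lerD.
Qed.

Lemma bmM f g : bounded_meas f -> bounded_meas g ->
  bounded_meas (fun w => f w * g w).
Proof.
move=> [mf [M Mf]] [mg [N Ng]]; split; first exact: measurable_funM.
by exists (M * N) => w; rewrite normrM ler_pM.
Qed.

Lemma bmZ r f : bounded_meas f -> bounded_meas (fun w => r * f w).
Proof. by move=> bf; apply: bmM => //; exact: bm_cst. Qed.

Lemma bm_sum (I : Type) (s : seq I) (Q : pred I) (f : I -> T -> R) :
  (forall i, Q i -> bounded_meas (f i)) ->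
  bounded_meas (fun w => \sum_(i <- s | Q i) f i w).
Proof.
move=> bf; elim: s => [|i s IHs].
  by under eq_fun do rewrite big_nil; exact: bm_cst.
under eq_fun do rewrite big_cons.
by have [/bf bi|_] := boolP (Q i); [exact: bmD|].
Qed.

Lemma bm_indic A : measurable A -> bounded_meas (\1_A : T -> R).
Proof.
move=> mA; split; first exact: measurable_indic.
by exists 1 => w; rewrite indicE; case: (_ \in _); rewrite ?normr1 ?normr0.
Qed.

Lemma ExD f g : bounded_meas f -> bounded_meas g ->
  Ex (fun w => f w + g w) = Ex f + Ex g.
Proof. by move=> bf bg; rewrite /Ex RintegralD//; exact: bm_integrable. Qed.

Lemma ExZ r f : bounded_meas f -> Ex (fun w => r * f w) = r * Ex f.
Proof. by move=> bf; rewrite /Ex RintegralZl//; exact: bm_integrable. Qed.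

Lemma Ex_cst r : Ex (fun=> r) = r.
Proof. by rewrite /Ex Rintegral_cst// -/(Pr setT) Pr_setT mulr1. Qed.

Lemma Ex_sum (I : Type) (s : seq I) (Q : pred I) (f : I -> T -> R) :
  (forall i, Q i -> bounded_meas (f i)) ->
  Ex (fun w => \sum_(i <- s | Q i) f i w) = \sum_(i <- s | Q i) Ex (f i).
Proof.
move=> bf; elim: s => [|i s IHs].
  by under eq_fun do rewrite big_nil; rewrite big_nil Ex_cst.
under eq_fun do rewrite big_cons; rewrite big_cons.
have [/bf bi|_] := boolP (Q i); last exact: IHs.
by rewrite ExD ?IHs//; exact: bm_sum.
Qed.

Lemma le_Ex f g : bounded_meas f -> bounded_meas g ->
  (forall w, f w <= g w) -> Ex f <= Ex g.
Proof. by move=> bf bg fg; apply: le_Rintegral => //; exact: bm_integrable. Qed.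

Lemma Ex_indic A : measurable A -> Ex \1_A = Pr A.
Proof. by move=> mA; rewrite /Ex /Rintegral integral_indic// setIT. Qed.

Lemma Pr_bigcup_le (I : finType) (Q : pred I) (A : I -> set T) (B : set T) :
  measurable B -> (forall i, Q i -> measurable (A i)) ->
  (forall w, B w -> exists2 i, Q i & A i w) -> Pr B <= \sum_(i | Q i) Pr (A i).
Proof.
move=> mB mA BA; rewrite -Ex_indic//.
rewrite (eq_bigr (fun i => Ex \1_(A i))); last first.
  by move=> i Qi; rewrite Ex_indic//; exact: mA.
rewrite -Ex_sum; last by move=> i Qi; apply: bm_indic; exact: mA.
apply: le_Ex; [exact: bm_indic|by apply: bm_sum => i Qi; apply: bm_indic; exact: mA|].
move=> w; rewrite indicE; case: (boolP (w \in B)) => [|_]; last first.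
  by apply: sumr_ge0 => i _; rewrite indicE.
rewrite inE => /BA[i Qi Aiw]; rewrite (bigD1 i)//= indicE mem_set//=.
by rewrite lerDl sumr_ge0// => j _; rewrite indicE.
Qed.

(** Off the full-measure set [V] nothing is known about [f]; multiplying by the indicator of [V]
    gives a bounded function with the same integral. *)
Lemma expectation_ae_le (V : set T) (f g : T -> R) : measurable V -> P (~` V) = 0%E ->
  measurable_fun setT f -> bounded_meas g -> (forall w, 0 <= g w) ->
  (forall w, V w -> 0 <= f w <= g w) -> ('E_P[f] <= (Ex g)%:E)%E.
Proof.
move=> mV V0 mf bg g0 fg; rewrite expectation.unlock.
have [mg [M Mg]] := bg.
have mfV : measurable_fun setT (fun w => f w * \1_V w).
  by apply: measurable_funM => //; exact: measurable_indic.
have leg w : 0 <= f w * \1_V w <= g w.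
  rewrite indicE; case: (boolP (w \in V)) => [|_]; last by rewrite mulr0 lexx/=.
  by rewrite inE mulr1; exact: fg.
have bfV : bounded_meas (fun w => f w * \1_V w).
  split => //; exists M => w; have /andP[h1 h2] := leg w.
  by rewrite ger0_norm// (le_trans h2)// (le_trans (ler_norm _)).
rewrite (ae_eq_integral (EFin \o (fun w => f w * \1_V w)))//; last first.
- exists (~` V); split => //; first exact: measurableC.
  move=> w /= /not_implyP[_ H] Vw; apply: H.
  by rewrite indicE mem_set// mulr1.
- exact/measurable_EFinP.
- exact/measurable_EFinP.
rewrite -[leLHS](@fineK R); last by apply: integrable_fin_num => //; exact: bm_integrable.
by rewrite lee_fin; apply: le_Ex => // w; have /andP[] := leg w.
Qed.

Lemma expectation_ae_ge (V : set T) (f g : T -> R) M : measurable V -> P (~` V) = 0%E ->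
  measurable_fun setT f -> bounded_meas g ->
  (forall w, V w -> g w <= f w <= M) -> ((Ex g)%:E <= 'E_P[f])%E.
Proof.
move=> mV V0 mf bg fg; rewrite expectation.unlock.
have [mg [N Ng]] := bg.
(* [h] agrees with [f] almost everywhere, dominates [g] everywhere, and is bounded thanks to [M] on
   [V] and the bound of [g] off [V]. *)
pose h w := f w * \1_V w + g w * \1_(~` V) w.
have mh : measurable_fun setT h.
  by apply: measurable_funD; apply: measurable_funM => //; apply: measurable_indic => //; exact: measurableC.
have hE w : V w -> h w = f w.
  by move=> Vw; rewrite /h !indicE in_setC mem_set//= mulr1 mulr0 addr0.
have hE' w : ~ V w -> h w = g w.
  by move=> Vw; rewrite /h !indicE in_setC memNset//= mulr1 mulr0 add0r.
have bh : bounded_meas h.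
  split => //; exists (N + `|M|) => w; case: (pselect (V w)) => Vw.
    rewrite hE//; have /andP[h1 h2] := fg _ Vw.
    move: (Ng w); rewrite !ler_norml => /andP[h3 h4].
    have := ler_norm M; have := normr_ge0 M; lra.
  by rewrite hE'// (le_trans (Ng w))// lerDl.
rewrite (ae_eq_integral (EFin \o h))//; last first.
- exists (~` V); split => //; first exact: measurableC.
  by move=> w /= /not_implyP[_ H] Vw; apply: H; rewrite hE.
- exact/measurable_EFinP.
- exact/measurable_EFinP.
rewrite -[leRHS](@fineK R); last by apply: integrable_fin_num => //; exact: bm_integrable.
rewrite lee_fin; apply: le_Ex => // w; case: (pselect (V w)) => Vw.
  by rewrite hE//; have /andP[] := fg _ Vw.
by rewrite hE'.
Qed.

End expectation_of_bounded_functions.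

(** * Uniform laws and independence *)

Section uniform_law.
Context (d : measure_display) (T : measurableType d) (R : realType).
Variables (P : probability T R) (X : {RV P >-> R}).
Hypothesis uX : uniform01 X.

Lemma uniform01_preimage (A : set R) : measurable A ->
  P (X @^-1` A) = lebesgue_measure (A `&` `[0, 1]%classic).
Proof.
move=> mA; have := uX mA; rewrite /distribution /pushforward => ->.
rewrite /uniform_prob integral_uniform_pdf.
rewrite (eq_integral (fun=> 1%E)).
  by rewrite integral_cst ?mul1e//; exact: measurableI.
move=> x; rewrite inE => -[_ /=]; rewrite in_itv/= => x01.
by rewrite /uniform_pdf x01 subr0 invr1.
Qed.

Lemma uniform01_le s : 0 <= s <= 1 -> Pr P (X @^-1` `]-oo, s]%classic) = s.
Proof.
move=> /andP[s0 s1]; rewrite /Pr uniform01_preimage//.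
have -> : `]-oo, s]%classic `&` `[0, 1]%classic = `[0, s]%classic :> set R.
  apply/seteqP; split => x /=; rewrite !in_itv/=.
    by move=> [-> /andP[->]].
  by move=> /andP[-> xs]; rewrite xs (le_trans xs s1).
rewrite lebesgue_measure_itv/= lte_fin; case: ltP => /= [_|]; first by rewrite subr0.
by move=> s0'; apply/eqP; rewrite eq_le s0 s0'.
Qed.

Lemma uniform01_itv s t : 0 <= s -> s <= t -> t <= 1 ->
  Pr P (X @^-1` `[s, t[%classic) = t - s.
Proof.
move=> s0 st t1; rewrite /Pr uniform01_preimage//.
have -> : `[s, t[%classic `&` `[0, 1]%classic = `[s, t[%classic :> set R.
  apply/seteqP; split => x /=; rewrite !in_itv/=; first by move=> [].
  move=> /andP[sx xt]; split; first by rewrite sx xt.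
  by rewrite (le_trans s0 sx) (le_trans (ltW xt) t1).
rewrite lebesgue_measure_itv/= lte_fin; case: ltP => //= ts.
by apply/eqP; rewrite eq_sym subr_eq0 eq_le st ts.
Qed.

Lemma uniform01_supp : P (X @^-1` ~` `[0, 1[%classic) = 0%E.
Proof.
have mX : measurable (X @^-1` `[0, 1[%classic) by apply: measurable_funPTI; exact: measurable_itv.
rewrite preimage_setC probability_setC// (Pr_EFin P mX).
by rewrite uniform01_itv// subr0 subee.
Qed.

End uniform_law.

(** * Independence of the sigma-algebras of disjoint subfamilies *)

Section independence.
Context (d : measure_display) (T : measurableType d) (R : realType).
Variables (P : probability T R) (I : finType) (X : I -> {RV P >-> R}).
Hypothesis indX : mutually_independent X.

Definition rect (J : {set I}) (A : I -> set R) : set T :=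
  \bigcap_(i in [set` J]) X i @^-1` A i.

(** The pi-system of cylinder events over [J]; it generates the sigma-algebra of the variables
    indexed by [J]. *)
Definition rects (J : {set I}) : set (set T) :=
  [set D | exists2 A, (forall i, measurable (A i)) & D = rect J A].

Definition sigma (J : {set I}) : set (set T) := <<s rects J >>.

Lemma measurable_rect (J : {set I}) (A : I -> set R) : (forall i, i \in J -> measurable (A i)) ->
  measurable (rect J A).
Proof.
move=> mA; apply: fin_bigcap_measurable => // i /= iJ.
by apply: measurable_funPTI; exact: mA.
Qed.

Lemma sigma_measurable (J : {set I}) D : sigma J D -> measurable D.
Proof.
apply: smallest_sub; first exact: sigma_algebra_measurable.
by move=> _ [A mA ->]; exact: measurable_rect.
Qed.

Lemma rects_setI J : setI_closed (rects J).
Proof.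
move=> _ _ [A mA ->] [B mB ->]; exists (fun i => A i `&` B i).
  by move=> i; exact: measurableI.
apply/seteqP; split => [w [h1 h2] i Ji|w h]; first by split; [exact: h1|exact: h2].
by split => i Ji; have [] := h _ Ji.
Qed.

Lemma sigma_preimage (J : {set I}) i (A : set R) : i \in J -> measurable A -> sigma J (X i @^-1` A).
Proof.
move=> iJ mA; apply: sub_sigma_algebra.
exists (fun j => if j == i then A else setT); first by move=> j; case: ifP.
apply/seteqP; split => w.
  by move=> h j /= _; case: eqP => // ->.
by move=> /(_ _ iJ); rewrite /= eqxx.
Qed.

Lemma rect_setU (J K : {set I}) (A : I -> set R) : rect (J :|: K) A = rect J A `&` rect K A.
Proof.
apply/seteqP; split => w.
  by move=> h; split => i /= iJ; apply: h; rewrite /= inE iJ ?orbT.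
by move=> [h1 h2] i /=; rewrite inE => /orP[|]; [exact: h1|exact: h2].
Qed.

(** As functions of [D], both sides are finite measures: [P] restricted to the cylinder over [K],
    and [P] scaled by a constant. They agree on the pi-system [rects J], hence on the sigma-algebra
    it generates. *)
Lemma sigma_indep (J K : {set I}) D (A : I -> set R) :
  (forall i, i \in J -> i \notin K) -> sigma J D ->
  (forall i, i \in K -> measurable (A i)) ->
  Pr P (D `&` rect K A) = Pr P D * \prod_(i in K) Pr P (X i @^-1` A i).
Proof.
move=> JK sD mA.
have mK : measurable (rect K A) by exact: measurable_rect.
have prodE (L : {set I}) B : (forall i, i \in L -> measurable (B i)) ->
    P (rect L B) = (\prod_(i in L) Pr P (X i @^-1` B i))%:E.
  move=> mB; rewrite indX// -prodEFin; apply: eq_bigr => i iL.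
  by rewrite Pr_EFin//; apply: measurable_funPTI; exact: mB.
have q0 : 0 <= \prod_(i in K) Pr P (X i @^-1` A i).
  by apply: prodr_ge0 => i _; exact: Pr_ge0.
pose m1 : {measure set T -> \bar R} := mrestr P mK.
pose m2 : {measure set T -> \bar R} := mscale (NngNum q0) P.
suff m12 : m1 D = m2 D.
  have : P (D `&` rect K A) = ((\prod_(i in K) Pr P (X i @^-1` A i))%:E * P D)%E.
    exact: m12.
  rewrite (Pr_EFin P (sigma_measurable sD)).
  rewrite (Pr_EFin P (measurableI _ _ (sigma_measurable sD) mK)) -EFinM => -[->].
  by rewrite mulrC.
apply: (@g_sigma_algebra_measure_unique _ _ _ (rects J) _ (fun=> setT)) => //.
- by move=> _ [B mB ->]; exact: measurable_rect.
- move=> _; exists (fun=> setT) => //.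
  by apply/esym/seteqP; split.
- by rewrite bigcup_const//; exists 0%N.
- exact: rects_setI.
- move=> _ [B mB ->].
  suff : P (rect J B `&` rect K A) =
    ((\prod_(i in K) Pr P (X i @^-1` A i))%:E * P (rect J B))%E by [].
  (* Since [J] and [K] are disjoint, the two families of sets merge into one, and the hypothesis of
     independence applies to [J :|: K]. *)
  pose C i := if i \in J then B i else A i.
  have -> : rect J B = rect J C.
    by apply: eq_bigcapr => i /= iJ; rewrite /C iJ.
  have KC i : i \in K -> C i = A i.
    by move=> iK; rewrite /C (contraTF (@JK i) iK).
  have -> : rect K A = rect K C by apply: eq_bigcapr => i /= iK; rewrite KC.
  have mC i : i \in J :|: K -> measurable (C i).
    by rewrite inE /C; case: ifPn => //= _; exact: mA.
  rewrite -rect_setU prodE// prodE; last first.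
    by move=> i iJ; apply: mC; rewrite inE iJ.
  rewrite -EFinM mulrC; congr EFin.
  have disJK : disjoint (mem J) (mem K).
    by apply/pred0P => i /=; apply/negP => /andP[/JK/negP].
  rewrite (eq_bigl [predU J & K]); last by move=> i; rewrite !inE.
  by rewrite bigU//= (eq_bigr _ (fun i iK => congr1 (fun Y => Pr P (X i @^-1` Y)) (KC i iK))) mulrC.
- by move=> _; rewrite (@le_lt_trans _ _ (P (setT `&` rect K A)))// (le_lt_trans (probability_le1 _ _))//; [exact: measurableI|exact: ltry].
Qed.

End independence.

(** * Ties *)

Section finite_connectives.
Context (d : measure_display) (T : measurableType d).

(** This and the next closure lemmas hold over any measurable type, so that they serve both for the
    ambient sigma-algebra and for one generated by a subfamily of the variables. *)
Lemma measurable_set_Prop (Q : Prop) : measurable [set _ : T | Q].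
Proof.
case: (pselect Q) => q.
  by rewrite (_ : [set _ | Q] = setT)//; apply/seteqP; split.
by rewrite (_ : [set _ | Q] = set0)//; apply/seteqP; split.
Qed.

Lemma measurable_set_exists (I : finType) (Q : I -> T -> Prop) :
  (forall i, measurable [set w | Q i w]) -> measurable [set w | exists i, Q i w].
Proof.
move=> mQ; rewrite (_ : [set w | exists i, Q i w] = \bigcup_(i in [set: I]) [set w | Q i w]).
  by apply: fin_bigcup_measurable => //; exact: finite_finset.
by apply/seteqP; split => w /= [i]; [exists i|move=> _; exists i].
Qed.

Lemma measurable_set_forall (I : finType) (Q : I -> T -> Prop) :
  (forall i, measurable [set w | Q i w]) -> measurable [set w | forall i, Q i w].
Proof.
move=> mQ; rewrite (_ : [set w | forall i, Q i w] = \bigcap_(i in [set: I]) [set w | Q i w]).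
  by apply: fin_bigcap_measurable => //; exact: finite_finset.
by apply/seteqP; split => w /= h i; [move=> _; exact: h|exact: h].
Qed.

Lemma measurable_set_and (Q Q' : T -> Prop) : measurable [set w | Q w] ->
  measurable [set w | Q' w] -> measurable [set w | Q w /\ Q' w].
Proof. exact: measurableI. Qed.

Lemma measurable_set_imp (Q : Prop) (Q' : T -> Prop) :
  measurable [set w | Q' w] -> measurable [set w | Q -> Q' w].
Proof.
move=> mQ; case: (pselect Q) => q.
  rewrite (_ : [set w | Q -> Q' w] = [set w | Q' w])//.
  by apply/seteqP; split => w /=; [apply|].
rewrite (_ : [set w | Q -> Q' w] = setT)//.
by apply/seteqP; split => // w _ /= /q.
Qed.

Lemma measurable_set_le (R : realType) (f g : T -> R) : measurable_fun setT f ->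
  measurable_fun setT g -> measurable [set w | f w <= g w].
Proof.
move=> mf mg; have mt : measurable [set true] by [].
by have := measurable_fun_ler mf mg measurableT mt; rewrite setTI.
Qed.

End finite_connectives.

Section almost_surely.
Context (d : measure_display) (T : measurableType d) (R : realType).
Variable P : probability T R.

Lemma Pr_setI_full (V A : set T) : measurable V -> P (~` V) = 0%E ->
  measurable A -> Pr P (A `&` V) = Pr P A.
Proof.
move=> mV V0 mA; rewrite /Pr; congr fine.
have AV0 : P (A `\` V) = 0%E.
  apply/eqP; rewrite eq_le measure_ge0 andbT -V0 setDE.
  by apply: le_measure; rewrite ?inE//; [apply: measurableI|]; rewrite ?setCK//; exact: measurableC.
have : P A = (P (A `\` V) + P (A `&` V))%E by exact: measureDI.
by rewrite AV0 add0e.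
Qed.

(** Disjointness is asked on [V] only, because the greedy state is unique only when there are no
    ties. *)
Lemma sum_Pr_disjoint_le1 (V : set T) (I : finType) (Q : pred I) (A : I -> set T) :
  measurable V -> P (~` V) = 0%E -> (forall i, Q i -> measurable (A i)) ->
  (forall w i j, V w -> Q i -> Q j -> A i w -> A j w -> i = j) ->
  \sum_(i | Q i) Pr P (A i) <= 1.
Proof.
move=> mV V0 mA dA.
rewrite (eq_bigr (fun i => Ex P \1_(A i `&` V))); last first.
  by move=> i Qi; rewrite Ex_indic ?Pr_setI_full//; [exact: mA|apply: measurableI => //; exact: mA].
have bA i : Q i -> bounded_meas (\1_(A i `&` V) : T -> R).
  by move=> Qi; apply: bm_indic; apply: measurableI => //; exact: mA.
rewrite -Ex_sum// -(Ex_cst P 1); apply: le_Ex; [exact: bm_sum|exact: bm_cst|].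
move=> w; case: (pselect (exists2 i, Q i & (A i `&` V) w)) => [[i Qi [Aiw Vw]]|nA].
  rewrite (bigD1 i)//= big1 ?addr0 ?indicE ?lern1 ?leq_b1//.
  move=> j /andP[Qj ji]; rewrite indicE memNset// => -[Ajw _].
  by move: ji; rewrite (dA w j i)// eqxx.
rewrite big1// => i Qi; rewrite indicE memNset// => h; apply: nA; by exists i.
Qed.

End almost_surely.

Section ties.
Context (d : measure_display) (T : measurableType d) (R : realType).
Variables (P : probability T R) (I : finType) (X : I -> {RV P >-> R}).
Hypothesis indX : mutually_independent X.

Lemma sigma_measurable_fun (J : {set I}) i : i \in J ->
  measurable_fun [set: g_sigma_algebraType (rects X J)] (X i : g_sigma_algebraType (rects X J) -> R).
Proof.
by move=> iJ _ A mA; rewrite setTI; exact: sigma_preimage.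
Qed.

Lemma sigma_measurable_funT (J : {set I}) (Y : T -> R) :
  measurable_fun [set: g_sigma_algebraType (rects X J)] (Y : g_sigma_algebraType (rects X J) -> R) ->
  measurable_fun [set: T] Y.
Proof.
by move=> mY _ A mA; apply: (@sigma_measurable _ _ _ _ _ X J); exact: mY.
Qed.

(** Cut [0,1) into [N] equal cells. Equality puts [X i] and [Y] in the same cell; as [Y] depends on
    [J] only, independence gives each cell probability 1/N times that of [Y] lying there, so at most
    1/N in total. *)
Lemma tie_null (J : {set I}) i (Y : T -> R) : i \notin J -> uniform01 (X i) ->
  measurable_fun [set: g_sigma_algebraType (rects X J)] (Y : g_sigma_algebraType (rects X J) -> R) ->
  P [set w | X i w = Y w] = 0%E.
Proof.
move=> iJ uX mY; have mY' := sigma_measurable_funT mY.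
pose V := X i @^-1` `[0, 1[%classic.
have mV : measurable V by apply: measurable_funPTI; exact: measurable_itv.
have V0 : P (~` V) = 0%E by have := uniform01_supp uX.
have mE : measurable [set w | X i w = Y w].
  rewrite (_ : [set w | X i w = Y w] = (fun w => X i w == Y w) @^-1` [set true]).
    have mt : measurable [set true] by [].
    have mXi : measurable_fun setT (X i) by [].
    by have := measurable_fun_eqr mXi mY' measurableT mt; rewrite setTI.
  by apply/seteqP; split => w /= /eqP.
rewrite (Pr_EFin P mE); congr EFin; apply/eqP; rewrite eq_le Pr_ge0 andbT.
rewrite -(Pr_setI_full mV V0 mE).
have main (N : nat) : (0 < N)%N -> Pr P ([set w | X i w = Y w] `&` V) <= N%:R^-1.
  move=> N0; have N0' : 0 < N%:R :> R by rewrite ltr0n.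
  pose itv (l : 'I_N) : set R := `[l%:R / N%:R, l.+1%:R / N%:R[%classic.
  have mI l : measurable (itv l) by exact: measurable_itv.
  have mXI l : measurable (X i @^-1` itv l) by apply: measurable_funPTI.
  have sYI l : sigma X J (Y @^-1` itv l).
    by have := mY measurableT _ (mI l); rewrite setTI.
  have mYI l : measurable (Y @^-1` itv l) by exact: sigma_measurable (sYI l).
  apply: (@le_trans _ _ (\sum_(l < N) Pr P (Y @^-1` itv l `&` rect X [set i]%SET (fun=> itv l)))).
    apply: Pr_bigcup_le.
    - exact: measurableI.
    - move=> l _; apply: measurableI => //; exact: measurable_rect.
    - move=> w [/= XY]; rewrite /V/= in_itv/= => /andP[X0 X1].
      have [l hl] : exists l : 'I_N, itv l (X i w).
        have trN : (Num.truncn (X i w * N%:R) < N)%N.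
          by rewrite truncn_lt_nat ?mulr_ge0// gtr_pMl.
        exists (Ordinal trN); rewrite /itv/= in_itv/= ler_pdivrMr// ltr_pdivlMr//.
        by have /truncn_itv : 0 <= X i w * N%:R by rewrite mulr_ge0.
      exists l => //; split; first by rewrite /= -XY.
      by move=> k /=; rewrite inE => /eqP ->.
  rewrite (eq_bigr (fun l => N%:R^-1 * Pr P (Y @^-1` itv l))); last first.
    move=> l _; rewrite (sigma_indep indX _ (sYI l))//; last first.
      by move=> k kJ; rewrite inE; apply: contraNneq iJ => <-.
    rewrite big_set1 uniform01_itv//.
    - by rewrite -mulrBl -natrB// subSnn mul1r mulrC.
    - by rewrite ler_pM2r ?invr_gt0// ler_nat.
    - by rewrite ler_pdivrMr// mul1r ler_nat.
  rewrite -mulr_sumr -[leRHS]mulr1 ler_wpM2l ?invr_ge0//.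
  apply: (@sum_Pr_disjoint_le1 _ _ _ P setT) => //; first by rewrite setCT measure0.
  move=> w l l' _ _ _; rewrite /itv/= !in_itv/= !ler_pdivrMr// !ltr_pdivlMr//.
  move=> /andP[h1 h2] /andP[h3 h4]; apply/val_inj/eqP => /=.
  have := le_lt_trans h1 h4; have := le_lt_trans h3 h2; rewrite !ltr_nat.
  by lia.
(* A positive probability p would contradict the bound for [N] the least integer above 1/p. *)
rewrite leNgt; apply/negP => p0.
have := main (Num.truncn (Pr P ([set w | X i w = Y w] `&` V))^-1).+1 isT.
apply/negP; rewrite -ltNge invf_plt ?posrE//.
by have /truncn_itv/andP[] : 0 <= (Pr P ([set w | X i w = Y w] `&` V))^-1 by rewrite invr_ge0 ltW.
Qed.

End ties.

(** * Greedy runs and bipartite graphs *)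

Section greedy.
Context (R : realType) (n : nat).
Variable W : 'I_n -> 'I_n -> 'I_n -> R.

(** The partial assignment is forgotten: later choices depend only on the free indices [B] and
    [C]. *)
Definition reach (m : nat) (B C : {set 'I_n}) : Prop :=
  exists S, greedy_run W m B C S.

Definition argmin_in (i : 'I_n) (B C : {set 'I_n}) (j k : 'I_n) : Prop :=
  [/\ j \in B, k \in C &
    forall j' k', j' \in B -> k' \in C -> W i j k <= W i j' k'].

Lemma reach0 B C : reach 0 B C <-> B = [set: 'I_n]%SET /\ C = [set: 'I_n]%SET.
Proof.
split; last by move=> [-> ->]; exists finset.set0; exact: greedy_init.
by move=> [S run]; inversion run.
Qed.

(** The recursion quantifies over finite types only, so that the event of reaching a state is a
    finite combination of earlier ones. *)
Lemma reachS m B' C' : reach m.+1 B' C' <->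
  exists x : 'I_n * 'I_n * 'I_n, exists BC : {set 'I_n} * {set 'I_n},
    ((x.1.1 = m :> nat) /\ B' = (BC.1 :\ x.1.2)%SET /\ C' = (BC.2 :\ x.2)%SET) /\
    (reach m BC.1 BC.2 /\ argmin_in x.1.1 BC.1 BC.2 x.1.2 x.2).
Proof.
split=> [[S run]|[[[i j] k] [[B C] /= [[<- [-> ->]] [[S run] [jB kC min]]]]]].
  inversion run as [|i B C S' j k run' jB kC min]; subst.
  by exists (i, j, k), (B, C); split => //=; split; [exists S'|].
by exists ((i, j, k) |: S)%SET; exact: greedy_step.
Qed.

Lemma reach_card m B C : reach m B C -> (#|B| = n - m)%N /\ (#|C| = n - m)%N.
Proof.
elim: m B C => [|m IHm] B C.
  by move=> /reach0[-> ->]; rewrite subn0 cardsT card_ord.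
move=> /reachS[[[i j] k] [[B1 C1] /= [[im [-> ->]] [/IHm[cB cC] [jB kC _]]]]].
have := cardsD1 j B1; have := cardsD1 k C1; rewrite jB kC cB cC /= => eC eB.
by split; rewrite subnS; [rewrite eB|rewrite eC].
Qed.

(** Without ties every minimiser is unique, so by induction on [m] the run is deterministic. *)
Lemma reach_inj m B C B' C' :
  (forall i j k j' k', W i j k = W i j' k' -> (j, k) = (j', k')) ->
  reach m B C -> reach m B' C' -> (B, C) = (B', C').
Proof.
move=> injW; elim: m B C B' C' => [|m IHm] B C B' C'.
  by move=> /reach0[-> ->] /reach0[-> ->].
move=> /reachS[[[i j] k] [[B1 C1] /= [[im [-> ->]] [r1 [jB kC min]]]]].
move=> /reachS[[[i' j'] k'] [[B2 C2] /= [[im' [-> ->]] [r2 [jB' kC' min']]]]].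
have [eB eC] := IHm _ _ _ _ r1 r2; subst B2 C2.
have eii : i = i' by apply: val_inj; rewrite /= im im'.
subst i'; have [-> ->] // : (j, k) = (j', k').
by apply: (injW i); apply/eqP; rewrite eq_le min// min'.
Qed.

Lemma greedy_run_step m B C S : greedy_run W m B C S ->
  forall i : 'I_n, (i < m)%N ->
  exists BC : {set 'I_n} * {set 'I_n}, exists j k,
    [/\ reach i BC.1 BC.2, (i, j, k) \in S & argmin_in i BC.1 BC.2 j k].
Proof.
elim=> {m B C S} [//|i B C S j k run IH jB kC min] i'.
rewrite ltnS leq_eqVlt => /orP[/eqP/val_inj ->|/IH[BC [j' [k' [r iS am]]]]].
  exists (B, C), j, k; split => //=; first by exists S.
  by rewrite !inE eqxx.
by exists BC, j', k'; split => //; rewrite inE iS orbT.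
Qed.

(** On the first [m] rows the permutations follow the greedy choices, whatever the completion. *)
Lemma greedy_output_step m sigma tau : greedy_output W m sigma tau ->
  forall i : 'I_n, (i < m)%N ->
  exists BC : {set 'I_n} * {set 'I_n}, reach i BC.1 BC.2 /\
    argmin_in i BC.1 BC.2 (sigma i) (tau i).
Proof.
move=> [B [C [S [run agree]]]] i im.
have [BC [j [k [r iS am]]]] := greedy_run_step run im.
by have [-> ->] := agree _ _ _ iS; exists BC.
Qed.

End greedy.

(** * Low-degree subgraphs of dense bipartite graphs *)

Section bipartite_graphs.
Variable n : nat.
Implicit Types (G : {set 'I_n * 'I_n}) (J K B C : {set 'I_n}).

Definition deg1 G (j : 'I_n) : nat := #|[set p in G | p.1 == j]|.
Definition deg2 G (k : 'I_n) : nat := #|[set p in G | p.2 == k]|.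

Definition low_degree G (D : nat) : bool :=
  [forall j, deg1 G j <= D]%N && [forall k, deg2 G k <= D]%N.

Lemma card_deg1 G : (#|G| = \sum_j deg1 G j)%N.
Proof.
rewrite -sum1_card (partition_big (fun p : 'I_n * 'I_n => p.1) predT)//=.
by apply: eq_bigr => j _; rewrite /deg1 -sum1_card; apply: eq_bigl => p; rewrite inE.
Qed.

Lemma card_deg2 G : (#|G| = \sum_k deg2 G k)%N.
Proof.
rewrite -sum1_card (partition_big (fun p : 'I_n * 'I_n => p.2) predT)//=.
by apply: eq_bigr => j _; rewrite /deg2 -sum1_card; apply: eq_bigl => p; rewrite inE.
Qed.

Lemma subset_of_card B h : (h <= #|B|)%N -> exists2 J : {set 'I_n}, J \subset B & #|J| = h.
Proof.
move=> hB; exists [set x in take h (enum B)]%SET.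
  by apply/fintype.subsetP => x; rewrite inE => /mem_take; rewrite mem_enum.
rewrite cardsE; have /card_uniqP -> : uniq (take h (enum B)).
  by apply: take_uniq; exact: enum_uniq.
by rewrite size_takel// -cardE.
Qed.

Definition edge_dense (G : {set 'I_n * 'I_n}) (h D : nat) : bool :=
  [forall J : {set 'I_n}, forall K : {set 'I_n},
    (#|J| == h) ==> (#|K| == h) ==> (D * h <= #|(G :&: finset.setX J K)%SET|)%N].

(* Take a maximal subgraph of degree at most D.  Either h vertices on one side
   are saturated, or the unsaturated vertices span a rectangle all of whose
   edges have been kept. *)
Lemma low_degree_subgraph G h D B C : edge_dense G h D ->
  (2 * h <= #|B|)%N -> (2 * h <= #|C|)%N ->
  exists H : {set 'I_n * 'I_n},
    [/\ H \subset G :&: finset.setX B C, low_degree H D & (D * h <= #|H|)%N].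
Proof.
move=> /forallP dG hB hC.
pose ok (H : {set 'I_n * 'I_n}) := (H \subset G :&: finset.setX B C) && low_degree H D.
have ok0 : ok finset.set0.
  rewrite /ok finset.sub0set /=; apply/andP; split; apply/forallP => x.
    by rewrite /deg1 (_ : [set p in _ | _]%SET = finset.set0) ?cards0//; apply/finset.setP => p; rewrite !inE.
  by rewrite /deg2 (_ : [set p in _ | _]%SET = finset.set0) ?cards0//; apply/finset.setP => p; rewrite !inE.
have [H /maxsetP[/andP[HG Hlow] Hmax] _] := maxset_exists ok0.
exists H; split => //.
have [/forallP low1 /forallP low2] := andP Hlow.
pose S1 := [set j in B | deg1 H j == D]%SET.
pose S2 := [set k in C | deg2 H k == D]%SET.
have [hS1|hS1] := leqP h #|S1|.
  rewrite card_deg1; apply: (@leq_trans (\sum_(j in S1) deg1 H j)%N).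
    rewrite (eq_bigr (fun=> D)); last by move=> j; rewrite inE => /andP[_ /eqP].
    by rewrite sum_nat_const mulnC leq_mul2r hS1 orbT.
  by rewrite [leqRHS](bigID (mem S1))/= leq_addr.
have [hS2|hS2] := leqP h #|S2|.
  rewrite card_deg2; apply: (@leq_trans (\sum_(j in S2) deg2 H j)%N).
    rewrite (eq_bigr (fun=> D)); last by move=> j; rewrite inE => /andP[_ /eqP].
    by rewrite sum_nat_const mulnC leq_mul2r hS2 orbT.
  by rewrite [leqRHS](bigID (mem S2))/= leq_addr.
(* Fewer than [h] of the at least [2 * h] vertices of [B] are saturated, which leaves [h]
   unsaturated ones; likewise in [C]. *)
have cB : (h <= #|B :\: S1|)%N.
  have := cardsID S1 B; rewrite (finset.setIidPr _); last by apply/fintype.subsetP => x; rewrite inE => /andP[].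
  by lia.
have cC : (h <= #|C :\: S2|)%N.
  have := cardsID S2 C; rewrite (finset.setIidPr _); last by apply/fintype.subsetP => x; rewrite inE => /andP[].
  by lia.
have [J JB cJ] := subset_of_card cB; have [K KC cK] := subset_of_card cC.
have := dG J => /forallP/(_ K); rewrite cJ cK !eqxx/= => /leq_trans; apply.
apply: subset_leq_card; apply/fintype.subsetP => -[j k]; rewrite !inE/= => /andP[pG /andP[jJ kK]].
have := fintype.subsetP JB _ jJ; rewrite !inE => /andP[/nandP nS1 jB].
have := fintype.subsetP KC _ kK; rewrite !inE => /andP[/nandP nS2 kC].
have dj : (deg1 H j < D)%N.
  by rewrite ltn_neqAle low1 andbT; case: nS1 => //; rewrite jB.
have dk : (deg2 H k < D)%N.
  by rewrite ltn_neqAle low2 andbT; case: nS2 => //; rewrite kC.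
(* Both ends of the edge have degree below [D], so adding it keeps the degree bound; maximality then
   puts it in [H]. *)
suff okH : ok ((j, k) |: H)%SET.
  by have <- := Hmax _ okH (finset.subsetUr _ _); rewrite !inE eqxx.
apply/andP; split.
  by rewrite finset.subUset HG andbT finset.sub1set !inE/= pG jB kC.
apply/andP; split; apply/forallP => x.
  have [xj|xj] := eqVneq x j.
    rewrite xj /deg1 (leq_trans (n := (deg1 H j).+1))//.
    rewrite (leq_trans (n := #|(j, k) |: [set p in H | p.1 == j]%SET|%SET))//.
      apply: subset_leq_card; apply/fintype.subsetP => p; rewrite !inE => /andP[/orP[->//|->] ->].
      by rewrite orbT.
    by rewrite cardsU1 /deg1; case: (_ \notin _); rewrite ?add1n ?add0n ?leqnSn.
  rewrite /deg1 (leq_trans _ (low1 x))// subset_leq_card//.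
  apply/fintype.subsetP => p; rewrite !inE => /andP[/orP[/eqP ->|->//]] /= /eqP jx.
  by move: xj; rewrite jx eqxx.
have [xk|xk] := eqVneq x k.
  rewrite xk /deg2 (leq_trans (n := (deg2 H k).+1))//.
  rewrite (leq_trans (n := #|(j, k) |: [set p in H | p.2 == k]%SET|%SET))//.
    apply: subset_leq_card; apply/fintype.subsetP => p; rewrite !inE => /andP[/orP[->//|->] ->].
    by rewrite orbT.
  by rewrite cardsU1 /deg2; case: (_ \notin _); rewrite ?add1n ?add0n ?leqnSn.
rewrite /deg2 (leq_trans _ (low2 x))// subset_leq_card//.
apply/fintype.subsetP => p; rewrite !inE => /andP[/orP[/eqP ->|->//]] /= /eqP jx.
by move: xk; rewrite jx eqxx.
Qed.

End bipartite_graphs.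

(** * Random graphs *)

Section subfamily.
Context (d : measure_display) (T : measurableType d) (R : realType).
Variables (P : probability T R) (I K : finType) (X : I -> {RV P >-> R}).

Lemma mutually_independent_comp (f : K -> I) : injective f ->
  mutually_independent X -> mutually_independent (X \o f).
Proof.
move=> injf indX J A mA.
(* The events are transported along the injection, with the whole line as default off its image. *)
pose B i := if [pick k | f k == i] is Some k then A k else setT.
have Bf k : B (f k) = A k.
  rewrite /B; case: pickP => [k' /eqP/injf ->//|/(_ k)].
  by rewrite eqxx.
transitivity (P (\bigcap_(i in [set` (f @: J)%SET]) X i @^-1` B i)).
  congr (P _); apply/seteqP; split => w h.
    by move=> i /= /imsetP[k kJ ->]; rewrite Bf; exact: h.
  by move=> k /= kJ; rewrite -Bf; apply: h => /=; exact: imset_f.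
rewrite indX.
  rewrite big_imset/=; last by move=> x y _ _; exact: injf.
  by apply: eq_bigr => k _; rewrite Bf.
by move=> i /imsetP[k kJ ->]; rewrite Bf; exact: mA.
Qed.

End subfamily.

Section random_graph.
Context (d : measure_display) (T : measurableType d) (R : realType).
Variables (P : probability T R) (K : finType) (Y : K -> {RV P >-> R}).
Hypothesis indY : mutually_independent Y.
Hypothesis uY : forall k, uniform01 (Y k).

Definition below (t : R) (w : T) : {set K} := [set k | Y k w <= t]%SET.

Lemma below_eq_rect t H : [set w | below t w = H] =
  rect Y [set: K]%SET (fun k => if k \in H then `]-oo, t]%classic
                                else ~` `]-oo, t]%classic).
Proof.
apply/seteqP; split => w /=.
  move=> <- k _ /=; rewrite inE; case: ifPn; rewrite /= in_itv//= => h.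
  by apply/negP.
move=> h; apply/setP => k; rewrite inE.
have /= := h k; rewrite inE => /(_ isT); case: ifPn => kH; rewrite /= in_itv//=.
by move/negP/negbTE.
Qed.

Lemma measurable_below t H : measurable [set w | below t w = H].
Proof.
rewrite below_eq_rect; apply: measurable_rect => k _.
by case: ifP => _ //; apply: measurableC.
Qed.

Lemma below_law t H : 0 <= t <= 1 ->
  Pr P [set w | below t w = H] = \prod_k (if k \in H then t else 1 - t).
Proof.
move=> t01; rewrite below_eq_rect /Pr /rect indY; last first.
  by move=> k _; case: ifP => _ //; apply: measurableC.
rewrite (eq_bigr (fun k => (if k \in H then t else 1 - t)%:E)).
  by rewrite prodEFin/=; apply: eq_bigl => k; rewrite inE.
move=> k _; have mY : measurable (Y k @^-1` `]-oo, t]%classic).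
  by apply: measurable_funPTI.
case: ifPn => kH; first by rewrite (Pr_EFin P mY) uniform01_le.
by rewrite preimage_setC probability_setC// (Pr_EFin P mY) uniform01_le.
Qed.

(** The expectation of 2 to the power minus the number of [k] in [S] with [Y k] at most [t]. By
    independence each index of [S] contributes a factor t/2 + (1 - t), and each other index a factor
    1. *)
Lemma below_laplace t (S : {set K}) : 0 <= t <= 1 ->
  \sum_(H : {set K}) Pr P [set w | below t w = H] * 2^-1 ^+ #|(H :&: S)%SET| =
  (1 - t / 2) ^+ #|S|.
Proof.
move=> t01.
pose F k := t * (if k \in S then 2^-1 else 1).
transitivity (\prod_k (F k + (1 - t))); last first.
  rewrite (bigID (mem S))/= [X in _ * X]big1 ?mulr1; last first.
    by move=> k /negbTE kS; rewrite /F kS; lra.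
  rewrite (eq_bigr (fun=> 1 - t / 2)); first by rewrite prodr_const.
  by move=> k kS; rewrite /F kS; lra.
(* Expanding the product of sums gives one term for each subset [H]. *)
rewrite bigA_distr; apply: eq_big => [H|H _]; first by rewrite inE.
rewrite below_law// -prodr_const.
rewrite [X in _ * X](_ : _ = \prod_k (if k \in (H :&: S)%SET then 2^-1 else 1)); last by rewrite -big_mkcond.
rewrite -big_split/=; apply: eq_bigr => k _; rewrite inE /F.
by case: (k \in H) => /=; rewrite ?mulr1.
Qed.

End random_graph.

(** * Sparse rectangles of a random bipartite graph *)

Section sparse_rectangles.
Context (d : measure_display) (T : measurableType d) (R : realType).
Variables (P : probability T R) (n : nat) (Y : 'I_n * 'I_n -> {RV P >-> R}).
Hypothesis indY : mutually_independent Y.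
Hypothesis uY : forall k, uniform01 (Y k).

(** An exponential Markov bound in base 2: a rectangle with fewer than [D * h] edges has weight at
    least 1 for [g]. Summing over all pairs of [h]-sets and using [below_laplace] on the [h * h]
    cells gives the right-hand side. *)
Lemma Pr_not_edge_dense (t : R) (h D : nat) : 0 <= t <= 1 ->
  \sum_(H : {set 'I_n * 'I_n} | ~~ edge_dense H h D) Pr P [set w | below Y t w = H] <=
  ('C(n, h) ^ 2)%:R * (2 ^+ (D * h) * (1 - t / 2) ^+ (h * h)).
Proof.
move=> t01.
pose Q (JK : {set 'I_n} * {set 'I_n}) := (#|JK.1| == h) && (#|JK.2| == h).
pose g (H : {set 'I_n * 'I_n}) (JK : {set 'I_n} * {set 'I_n}) : R :=
  2 ^+ (D * h) * 2^-1 ^+ #|(H :&: finset.setX JK.1 JK.2)%SET|.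
have g0 H JK : 0 <= g H JK by rewrite mulr_ge0// exprn_ge0// invr_ge0.
have p0 H : 0 <= Pr P [set w | below Y t w = H] by exact: Pr_ge0.
apply: (@le_trans _ _ (\sum_H \sum_(JK | Q JK) Pr P [set w | below Y t w = H] * g H JK)).
  rewrite [leRHS](bigID (fun H => ~~ edge_dense H h D))/= -[leLHS]addr0 lerD//; last first.
    by apply: sumr_ge0 => H _; apply: sumr_ge0 => JK _; rewrite mulr_ge0.
  apply: ler_sum => H; rewrite negb_forall => /existsP[J].
  rewrite negb_forall => /existsP[K]; rewrite !negb_imply -ltnNge => /and3P[cJ cK lt].
  rewrite (bigD1 (J, K))/=; last by rewrite /Q/= cJ cK.
  rewrite -[leLHS]addr0 lerD//; last by apply: sumr_ge0 => JK _; rewrite mulr_ge0.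
  rewrite ler_peMr// /g/= exprVn ler_pdivlMr ?exprn_gt0// mul1r.
  by rewrite ler_weXn2l ?ler1n// ltnW.
rewrite exchange_big/=.
rewrite (eq_bigr (fun=> 2 ^+ (D * h) * (1 - t / 2) ^+ (h * h))); last first.
  move=> [J K] /andP[/= /eqP cJ /eqP cK].
  rewrite (_ : (h * h)%N = #|finset.setX J K|); last by rewrite cardsX cJ cK.
  rewrite -(below_laplace indY uY _ t01) mulr_sumr; apply: eq_bigr => H _.
  by rewrite /g/= mulrCA.
rewrite sumr_const -[leLHS]mulr_natl.
rewrite (_ : #|_| = ('C(n, h) ^ 2)%N)//.
rewrite (eq_card (B := mem (finset.setX [set J : {set 'I_n} | #|J| == h]%SET
  [set J : {set 'I_n} | #|J| == h]%SET))); last by move=> JK; rewrite !inE.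
by rewrite cardsX card_draws card_ord mulnn.
Qed.

End sparse_rectangles.

(** * Numerical estimates *)

Section numeric_bounds.
Variable R : realType.

(** With x = 1/m, Bernoulli gives (1 + x)^m >= 2, and (1 - x)^m (1 + x)^m <= 1, so (1 - x)^m <= 1/2.
    Finally 1 - 2x <= (1 - x)^2. *)
Lemma one_sub_div_pow_le (m : nat) : (2 <= m)%N ->
  (1 - 2 / m%:R) ^+ m <= 4^-1 :> R.
Proof.
move=> m2; have m0 : 0 < m%:R :> R by rewrite ltr0n; lia.
have m2' : 2 <= m%:R :> R by rewrite ler_nat.
pose x : R := m%:R^-1; have x0 : 0 < x by rewrite invr_gt0.
have x1 : x <= 2^-1 by rewrite /x lef_pV2// posrE.
have bern k : 1 + k%:R * x <= (1 + x) ^+ k.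
  elim: k => [|k IHk]; first by rewrite mul0r addr0 expr0.
  rewrite exprS -natr1; apply: (@le_trans _ _ ((1 + x) * (1 + k%:R * x))).
    have : 0 <= k%:R * x * x by rewrite !mulr_ge0// ltW.
    lra.
  by rewrite ler_wpM2l//; lra.
have h2 : 2 <= (1 + x) ^+ m.
  by have := bern m; rewrite /x mulfV ?gt_eqF//; lra.
have hx : (1 - x) ^+ m * (1 + x) ^+ m <= 1.
  rewrite -exprMn exprn_ile1//; nra.
have hy : 0 <= (1 - x) ^+ m by rewrite exprn_ge0//; lra.
have h3 : (1 - x) ^+ m <= 2^-1 by nra.
have -> : 2 / m%:R = 2 * x by [].
apply: (@le_trans _ _ (((1 - x) ^+ 2) ^+ m)).
  by apply: lerXn2r; rewrite ?nnegrE; nra.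
rewrite exprAC; nra.
Qed.

(** A polynomial in [q] against an exponential: with k = q %/ 48, q + 1 <= 48 (k + 1) <= 2^(6 +
    k). *)
Lemma sqr_le_pow2 (n q : nat) : (306 <= q)%N ->
  (n <= (2 * q.+1 ^ 3) ^ 4)%N -> (n ^ 2 * 2 <= 2 ^ q)%N.
Proof.
move=> q306 nq; pose k := (q %/ 48)%N.
have kq : (q.+1 <= 48 * k.+1)%N by have := ltn_ceil q (isT : (0 < 48)%N); rewrite -/k; lia.
have k2 : (k.+1 <= 2 ^ k)%N by exact: ltn_expl.
have q64 : (q.+1 <= 2 ^ (6 + k))%N.
  by rewrite expnD (leq_trans kq)// leq_mul.
apply: (@leq_trans (((2 * (2 ^ (6 + k)) ^ 3) ^ 4) ^ 2 * 2)).
  rewrite leq_mul2r/= leq_exp2r// (leq_trans nq)// leq_exp2r// leq_mul2l/=.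
  by rewrite leq_exp2r.
(* The exponent is 24 k + 153, where 48 k <= q and 2 * 153 = 306 <= q; this is the origin of the
   threshold 306. *)
rewrite -!expnM -(expnS 2) -!expnM -expnSr leq_exp2l//.
by have := leq_trunc_div q 48; rewrite -/k; lia.
Qed.

Lemma leq_bin_exp n h : ('C(n, h) <= n ^ h)%N.
Proof.
have h1 : (n ^_ h <= n ^ h)%N.
  elim: h => [|h IHh]; first by rewrite ffactn0.
  by rewrite ffactnSr expnSr leq_mul// leq_subr.
by rewrite (leq_trans _ h1)// -bin_ffact leq_pmulr// fact_gt0.
Qed.

(** The bound of [Pr_not_edge_dense] at h = q^3, D = q, t = 4/q^2. The power of 1 - 2/q^2 is at most
    4^(-q^4), so the second factor is at most 2^(-q^4); the pairs of sets number at most n^(2 q^3)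
    <= 2^((q - 1) q^3). The product is at most 2^(-q^3). *)
Lemma sparse_union_bound (n q : nat) : (306 <= q)%N ->
  (n <= (2 * q.+1 ^ 3) ^ 4)%N ->
  ('C(n, q ^ 3) ^ 2)%:R *
    (2 ^+ (q * q ^ 3) * (1 - (4 / (q ^ 2)%:R) / 2) ^+ (q ^ 3 * q ^ 3))
  <= (q ^ 2)%:R^-1 :> R.
Proof.
move=> q306 nq.
have -> : (4 / (q ^ 2)%:R) / 2 = 2 / (q ^ 2)%:R :> R by rewrite mulrAC; congr (_ / _); lra.
have -> : (q ^ 3 * q ^ 3 = q ^ 2 * q ^ 4)%N by rewrite -!expnD.
have -> : (q * q ^ 3 = q ^ 4)%N by rewrite -expnS.
have h1 : 0 <= (1 - 2 / (q ^ 2)%:R : R) ^+ (q ^ 2) <= 4^-1.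
  have q2 : (2 <= q ^ 2)%N by rewrite (@leq_trans (2 ^ 2))// leq_exp2r//; lia.
  apply/andP; split; last exact: one_sub_div_pow_le.
  rewrite exprn_ge0// subr_ge0 ler_pdivrMr ?mul1r ?ler_nat// ltr0n.
  by lia.
have h2 : (1 - 2 / (q ^ 2)%:R) ^+ (q ^ 2 * q ^ 4) <= 4^-1 ^+ (q ^ 4) :> R.
  by rewrite exprM; apply: lerXn2r; rewrite ?nnegrE; case/andP: h1 => // ? ?; exact: le_trans h1.
have h3 : 2 ^+ (q ^ 4) * (1 - 2 / (q ^ 2)%:R) ^+ (q ^ 2 * q ^ 4) <= 2^-1 ^+ (q ^ 4) :> R.
  apply: (@le_trans _ _ (2 ^+ (q ^ 4) * 4^-1 ^+ (q ^ 4))).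
    by rewrite ler_wpM2l// exprn_ge0.
  by rewrite -exprMn (_ : 2 * 4^-1 = 2^-1 :> R)//; lra.
have h4 : ('C(n, q ^ 3) ^ 2)%:R <= (2 ^ (q - 1))%:R ^+ (q ^ 3) :> R.
  rewrite -natrX ler_nat (@leq_trans ((n ^ (q ^ 3)) ^ 2))//.
    by rewrite leq_exp2r// leq_bin_exp.
  rewrite -expnM mulnC expnM leq_exp2r; last by rewrite expn_gt0; lia.
  rewrite -(@leq_pmul2r 2)// (leq_trans (sqr_le_pow2 q306 nq))//.
  by rewrite -expnSr leq_exp2l//; lia.
apply: (@le_trans _ _ ((2 ^ (q - 1))%:R ^+ (q ^ 3) * 2^-1 ^+ (q ^ 4))).
  apply: ler_pM => //; apply: mulr_ge0; first exact: exprn_ge0.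
  by rewrite exprM exprn_ge0//; case/andP: h1.
rewrite (_ : (q ^ 4 = q * q ^ 3)%N); last by rewrite -expnS.
rewrite [2^-1 ^+ _]exprM -exprMn.
have -> : (2 ^ (q - 1))%:R * 2^-1 ^+ q = 2^-1 :> R.
  have -> : 2^-1 ^+ q = 2^-1 ^+ (q - 1) * 2^-1 :> R by rewrite -exprSr; congr (_ ^+ _); lia.
  by rewrite natrX exprVn mulrA mulfV ?mul1r// expf_neq0.
rewrite exprVn lef_pV2 ?posrE ?exprn_gt0// ?ltr0n ?expn_gt0; last by lia.
rewrite -natrX ler_nat (@leq_trans (q ^ 3))//.
  by rewrite leq_pexp2l//; lia.
by rewrite ltnW// ltn_expl.
Qed.

(** Telescoping: 1/(x + 1)^2 <= 1/x - 1/(x + 1), by induction on the sharper bound 2 - 1/(k + 1). *)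
Lemma sum_inv_sqr_le2 (q : nat) : \sum_(l < q) ((l.+1%:R) ^+ 2)^-1 <= 2 :> R.
Proof.
have main k : \sum_(l < k.+1) ((l.+1%:R) ^+ 2)^-1 <= 2 - k.+1%:R^-1 :> R.
  elim: k => [|k IHk]; first by rewrite big_ord1/= (_ : 1%:R = 1 :> R)// expr1n invr1 lerBrDr.
  rewrite big_ord_recr/=; apply: (le_trans (lerD IHk (lexx _))).
  have k0 : 0 < k.+1%:R :> R by rewrite ltr0n.
  rewrite -[k.+2%:R]natr1; set x : R := k.+1%:R in k0 *.
  have x1 : 0 < x + 1 by lra.
  suff : ((x + 1) ^+ 2)^-1 <= x^-1 - (x + 1)^-1.
    by move: ((x + 1) ^+ 2)^-1 x^-1 (x + 1)^-1 => u v z; lra.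
  have -> : x^-1 - (x + 1)^-1 = (x * (x + 1))^-1 by field; rewrite !gt_eqF.
  by rewrite lef_pV2 ?posrE ?exprn_gt0 ?mulr_gt0// expr2 ler_pM2r//; lra.
case: q => [|q]; first by rewrite big_ord0.
by rewrite (le_trans (main q))// gerBl invr_ge0.
Qed.

End numeric_bounds.

(** * The second moment bound *)

Section second_moment.
Context (d : measure_display) (T : measurableType d) (R : realType).
Variables (P : probability T R) (I : finType) (X : I -> {RV P >-> R}).
Hypothesis indX : mutually_independent X.
Hypothesis uX : forall x, uniform01 (X x).
Variables (n : nat) (f g : 'I_n -> I) (J : {set I}) (D : set T).
Hypothesis injf : injective f.
Hypothesis injg : injective g.
Hypothesis fg : forall j k, f j != g k.
Hypothesis fJ : forall j, f j \notin J.
Hypothesis gJ : forall k, g k \notin J.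
Hypothesis sD : sigma X J D.

(** In the application [f] and [g] index the entries of the current row of the first two arrays, [J]
    the variables already revealed, and [D] an event of the past that fixes the graph [H]. *)
Definition hits (H : {set 'I_n * 'I_n}) (s : R) (w : T) : Prop :=
  exists2 p, p \in H & X (f p.1) w <= s /\ X (g p.2) w <= s.

Definition misses (H : {set 'I_n * 'I_n}) (s : R) : set T :=
  [set w | ~ hits H s w].

Definition hit (s : R) (p : 'I_n * 'I_n) : set T :=
  rect X [set f p.1; g p.2]%SET (fun=> `]-oo, s]%classic).

Lemma measurable_hit s p : measurable (hit s p).
Proof. exact: measurable_rect. Qed.

Lemma hitE s p w : hit s p w <-> X (f p.1) w <= s /\ X (g p.2) w <= s.
Proof.
split=> [h|[h1 h2] x]; last first.
  rewrite /= in_itv/= => xK; have : x \in [set f p.1; g p.2]%SET by [].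
  by rewrite finset.in_set2 => /orP[] /eqP ->.
have h1 := h (f p.1); have h2 := h (g p.2); move: h1 h2.
rewrite /= !in_itv/= !finset.in_set2 !eqxx orbT => h1 h2.
by split; [exact: h1|exact: h2].
Qed.

Lemma measurable_misses H s : measurable (misses H s).
Proof.
rewrite (_ : misses H s = ~` \bigcup_(p in [set` H]) hit s p).
  apply: measurableC; apply: fin_bigcup_measurable => //.
  by move=> p _; exact: measurable_hit.
apply/seteqP; split => w /=.
  by move=> h [p /= pH /hitE hp]; apply: h; exists p.
by move=> h [p pH hp]; apply: h; exists p => //; apply/hitE.
Qed.

Let mD : measurable D := sigma_measurable sD.

Lemma Pr_rect_le (K : {set I}) s : 0 <= s <= 1 -> (forall x, x \in K -> x \notin J) ->
  Pr P (D `&` rect X K (fun=> `]-oo, s]%classic)) = Pr P D * s ^+ #|K|.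
Proof.
move=> s01 KJ; rewrite (sigma_indep indX _ sD)//; last first.
  by move=> x xJ; apply: contraTN xJ => /KJ.
by rewrite -prodr_const; congr (_ * _); apply: eq_bigr => x _; rewrite uniform01_le.
Qed.

Let pairJ p x : x \in [set f p.1; g p.2]%SET -> x \notin J.
Proof. by rewrite !inE => /orP[] /eqP ->. Qed.

Lemma Pr_hit s p : 0 <= s <= 1 -> Pr P (D `&` hit s p) = Pr P D * s ^+ 2.
Proof.
move=> s01; rewrite Pr_rect_le// ?cards2 ?fg//.
by move=> x; exact: pairJ.
Qed.

(** The exact exponent of [s] is the number of distinct variables at the ends of the two edges: 4
    for disjoint edges, 3 for one shared end, 2 for equal edges. Adding the cases keeps the bound
    summable term by term. *)
Lemma Pr_hit2 s p p' : 0 <= s <= 1 ->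
  Pr P (D `&` (hit s p `&` hit s p')) <= Pr P D *
   (s ^+ 4 + (p'.1 == p.1)%:R * s ^+ 3 + (p'.2 == p.2)%:R * s ^+ 3
     + (p' == p)%:R * s ^+ 2).
Proof.
move=> s01; have /andP[s0 s1] := s01.
rewrite -rect_setU Pr_rect_le//; last first.
  by move=> x; rewrite inE => /orP[]; exact: pairJ.
apply: ler_wpM2l; first exact: Pr_ge0.
have e2 : 0 <= s ^+ 2 by rewrite exprn_ge0.
have e3 : 0 <= s ^+ 3 by rewrite exprn_ge0.
have e4 : 0 <= s ^+ 4 by rewrite exprn_ge0.
case: p p' => [j k] [j' k'] /=; rewrite xpair_eqE.
have [->|jj] := eqVneq j' j; have [->|kk] := eqVneq k' k => /=.
- by rewrite finset.setUid cards2 fg; lra.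
- rewrite (_ : (_ :|: _)%SET = (f j |: [set g k; g k'])%SET).
    rewrite cardsU1 cards2 !inE !negb_or !fg/= (inj_eq injg) eq_sym kk/=.
    by rewrite (_ : (1 + 2 = 3)%N)//; lra.
  by apply/finset.setP => x; rewrite !inE; do ?case: eqP.
- rewrite (_ : (_ :|: _)%SET = (g k |: [set f j; f j'])%SET).
    rewrite cardsU1 cards2 !inE !negb_or ![g k == _]eq_sym !fg/= (inj_eq injf) eq_sym jj/=.
    by rewrite (_ : (1 + 2 = 3)%N)//; lra.
  by apply/finset.setP => x; rewrite !inE; do ?case: eqP.
- rewrite cardsU (_ : (_ :&: _)%SET = finset.set0); last first.
    apply/finset.setP => x; rewrite !inE; apply/negP => /andP[/orP[]/eqP-> /orP[]].
    + by rewrite (inj_eq injf) eq_sym (negbTE jj).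
    + by rewrite (negbTE (fg _ _)).
    + by rewrite eq_sym (negbTE (fg _ _)).
    + by rewrite (inj_eq injg) eq_sym (negbTE kk).
  by rewrite cards0 !cards2 !fg/= (_ : (2 + 2 - 0 = 4)%N)//; lra.
Qed.

(** Chebyshev for the number [N] of edges hit, of mean e s^2 with e = #|H|. The degree bound limits
    the correlated pairs, so the variance is at most e s^2 + 2 e Delta s^3; dividing by (e s^2)^2
    gives the claim. Conditioning on [D] is replaced by the weight [\1_D]. *)
Lemma Pr_misses (H : {set 'I_n * 'I_n}) (Delta : nat) s : 0 < s <= 1 -> (0 < #|H|)%N ->
  low_degree H Delta ->
  Pr P (D `&` misses H s) <= Pr P D *
    ((#|H|%:R * s ^+ 2)^-1 + 2 * Delta%:R / (#|H|%:R * s)).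
Proof.
move=> /andP[s0 s1] H0 /andP[/forallP low1 /forallP low2].
have s01 : 0 <= s <= 1 by rewrite ltW.
set e : R := #|H|%:R; have e0 : 0 < e by rewrite ltr0n.
pose N w : R := \sum_(p in H) \1_(hit s p) w.
have mhit p := measurable_hit s p.
pose D1 : T -> R := \1_D.
have bD : bounded_meas D1 by exact: bm_indic.
have bN : bounded_meas N by apply: bm_sum => p _; exact: bm_indic.
have EN : Ex P (fun w => D1 w * N w) = Pr P D * (e * s ^+ 2).
  rewrite (_ : (fun w => _) = fun w => \sum_(p in H) \1_(D `&` hit s p) w); last first.
    by apply/funext => w; rewrite /N mulr_sumr; apply: eq_bigr => p _; rewrite indicI.
  rewrite Ex_sum; last by move=> p _; apply: bm_indic; exact: measurableI.
  rewrite (eq_bigr (fun=> Pr P D * s ^+ 2)); last first.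
    by move=> p _; rewrite Ex_indic ?Pr_hit//; exact: measurableI.
  by rewrite sumr_const -mulr_natl -/e; ring.
have EN2 : Ex P (fun w => D1 w * (N w * N w)) <=
    Pr P D * (e ^+ 2 * s ^+ 4 + 2 * (e * Delta%:R * s ^+ 3) + e * s ^+ 2).
  rewrite (_ : (fun w => _) = fun w => \sum_(p in H) \sum_(p' in H)
      \1_(D `&` (hit s p `&` hit s p')) w); last first.
    apply/funext => w; rewrite /N mulr_suml mulr_sumr; apply: eq_bigr => p _.
    by rewrite mulr_sumr mulr_sumr; apply: eq_bigr => p' _; rewrite !indicI.
  have m2 p p' : measurable (D `&` (hit s p `&` hit s p')).
    by apply: measurableI => //; exact: measurableI.
  rewrite Ex_sum; last by move=> p _; apply: bm_sum => p' _; exact: bm_indic.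
  apply: (@le_trans _ _ (\sum_(p in H) Pr P D *
      (e * s ^+ 4 + Delta%:R * s ^+ 3 + Delta%:R * s ^+ 3 + s ^+ 2))); last first.
    by rewrite sumr_const -mulr_natl -/e le_eqVlt; apply/orP; left; apply/eqP; ring.
  apply: ler_sum => p pH; rewrite Ex_sum; last by move=> p' _; exact: bm_indic.
  apply: (@le_trans _ _ (\sum_(p' in H) Pr P D *
    (s ^+ 4 + (p'.1 == p.1)%:R * s ^+ 3 + (p'.2 == p.2)%:R * s ^+ 3
     + (p' == p)%:R * s ^+ 2))).
    by apply: ler_sum => p' _; rewrite Ex_indic// Pr_hit2.
  rewrite -mulr_sumr; apply: ler_wpM2l; first exact: Pr_ge0.
  rewrite !big_split/=.
  rewrite (_ : \sum_(i in H) s ^+ 4 = e * s ^+ 4); last by rewrite sumr_const mulr_natl.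
  rewrite -!mulr_suml.
  have sumE (Q : pred ('I_n * 'I_n)) :
      \sum_(p' in H) (Q p')%:R = #|[set p' in H | Q p']%SET|%:R :> R.
    rewrite -sum1_card natr_sum [RHS]big_mkcond [LHS]big_mkcond/=.
    by apply: eq_bigr => p' _; rewrite inE; case: (p' \in H); case: (Q p').
  rewrite !sumE; apply: lerD; first apply: lerD; first apply: lerD => //.
  - by rewrite ler_wpM2r ?exprn_ge0 ?(ltW s0)// ler_nat; exact: low1.
  - by rewrite ler_wpM2r ?exprn_ge0 ?(ltW s0)// ler_nat; exact: low2.
  - rewrite -[leRHS]mul1r ler_wpM2r ?exprn_ge0 ?(ltW s0)// (ler_nat _ _ 1).
    rewrite -(cards1 p); apply: subset_leq_card; apply/fintype.subsetP => p'.
    by rewrite !inE => /andP[].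
have mM := measurable_misses H s.
have mDM : measurable (D `&` misses H s) by exact: measurableI.
(* On a miss [N] vanishes, so the squared deviation of [N] from its mean equals (e s^2)^2; elsewhere
   it is nonnegative. *)
have cheb : Pr P (D `&` misses H s) * (e * s ^+ 2) ^+ 2 <=
    Ex P (fun w => D1 w * (N w * N w)) - 2 * (e * s ^+ 2) * Ex P (fun w => D1 w * N w)
    + (e * s ^+ 2) ^+ 2 * Pr P D.
  have bDN : bounded_meas (fun w => D1 w * N w) by exact: bmM.
  have bDNN : bounded_meas (fun w => D1 w * (N w * N w)) by apply: bmM => //; exact: bmM.
  have bI : bounded_meas (\1_(D `&` misses H s) : T -> R) by exact: bm_indic.
  have b1 := bmZ (- (2 * (e * s ^+ 2))) bDN; have b2 := bmZ ((e * s ^+ 2) ^+ 2) bD.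
  have b3 := bmD bDNN b1.
  rewrite -(Ex_indic P mDM) -(Ex_indic P mD) -/D1 mulrC -mulNr.
  rewrite -(ExZ P _ bI) -(ExZ P _ bDN) -(ExZ P _ bD) -(ExD P bDNN b1) -(ExD P b3 b2).
  apply: le_Ex; [exact: bmZ|exact: bmD|].
  move=> w; rewrite [\1_(_ `&` _)]indicI -/D1 /= -!mulNr.
  have D0 : D1 w = 0 \/ D1 w = 1.
    by rewrite /D1 indicE; case: (w \in D); [right|left].
  have [hw|hw] := pselect (misses H s w).
    rewrite (_ : N w = 0); last first.
      apply: big1 => p pH; rewrite indicE memNset// => /hitE hp; apply: hw.
      by exists p.
    by rewrite [\1_(misses _ _) w]indicE mem_set//= !(mulr1, mulr0, addr0, add0r).
  rewrite [\1_(misses _ _) w]indicE memNset// !mulr0.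
  have : 0 <= (N w - e * s ^+ 2) ^+ 2 by exact: sqr_ge0.
  by case: D0 => ->; nra.
have p0 : 0 <= Pr P D by exact: Pr_ge0.
have es0 : 0 < e * s ^+ 2 by rewrite mulr_gt0// exprn_gt0.
rewrite -(ler_pM2r (exprn_gt0 2 es0)) (le_trans cheb)// EN.
rewrite [leRHS](_ : _ = Pr P D * (e * s ^+ 2 + 2 * (e * Delta%:R * s ^+ 3))); last first.
  by field; rewrite !gt_eqF.
by move: EN2; lra.
Qed.

(** The levels are l/q^2 for l = 1, ..., q. In the constant term, 4/q^2 pays for the entry of [c]
    and 2/q^2 for the first level of the other two; each missed level adds 2/q^2. The last term
    covers the case where level [q] is missed as well, when those two entries are only known to be
    at most 1. *)
Definition step_bound (q : nat) (H : {set 'I_n * 'I_n}) (w : T) : R :=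
  6 / (q ^ 2)%:R
  + (2 / (q ^ 2)%:R * (\sum_(l < q) \1_(misses H (l.+1%:R / (q ^ 2)%:R)) w)
  + 2 * \1_(misses H (q%:R / (q ^ 2)%:R)) w).

Lemma step_bound_ge0 q H w : 0 <= step_bound q H w.
Proof.
rewrite /step_bound !addr_ge0// ?mulr_ge0// ?invr_ge0//.
by apply: sumr_ge0 => l _; rewrite indicE.
Qed.

Lemma bm_step_bound q H : bounded_meas (step_bound q H).
Proof.
apply: bmD; first exact: bm_cst.
by apply: bmD; apply: bmZ; [apply: bm_sum => l _|]; apply: bm_indic;
  exact: measurable_misses.
Qed.

(* If the smallest level l with a hit is at most q then the levels below l all
   contribute to the sum; otherwise the last indicator is 1. *)
Lemma le_step_bound (q : nat) (H : {set 'I_n * 'I_n}) w (v : R) : (0 < q)%N -> (0 < #|H|)%N ->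
  (forall j, X (f j) w <= 1) -> (forall k, X (g k) w <= 1) ->
  (forall p, p \in H -> v <= 4 / (q ^ 2)%:R + (X (f p.1) w + X (g p.2) w)) ->
  v <= step_bound q H w.
Proof.
move=> q0 H0 f1 g1 vH; have Q0 : 0 < (q ^ 2)%:R :> R by rewrite ltr0n expn_gt0 q0.
set Q : R := (q ^ 2)%:R in Q0 vH *.
have Qi : 0 < Q^-1 by rewrite invr_gt0.
have sum0 : 0 <= \sum_(l < q) \1_(misses H (l.+1%:R / Q)) w :> R.
  by apply: sumr_ge0 => l _; rewrite indicE.
have ind0 : 0 <= \1_(misses H (q%:R / Q)) w :> R by rewrite indicE.
rewrite /step_bound -/Q.
have [hq|mq] := pselect (hits H (q%:R / Q) w); last first.
  have [p pH] : exists p, p \in H by apply/card_gt0P.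
  have := vH _ pH; have := f1 p.1; have := g1 p.2.
  have : 0 <= 2 / Q * \sum_(l < q) \1_(misses H (l.+1%:R / Q)) w :> R.
    by rewrite !mulr_ge0// ltW.
  by rewrite [\1_(misses H (q%:R / Q)) w]indicE mem_set//=; lra.
have ex : exists l, (0 < l)%N && `[< hits H (l%:R / Q) w >].
  by exists q; rewrite q0; apply/asboolP.
case: (ex_minnP ex) => l /andP[l0 /asboolP[p pH [h1 h2]]] lmin.
have lq : (l <= q)%N by apply: lmin; rewrite q0; apply/asboolP.
have : (l.-1)%:R <= \sum_(i < q) \1_(misses H (i.+1%:R / Q)) w :> R.
  rewrite -(subnKC (leq_trans (leq_pred l) lq)) big_split_ord/=.
  apply: (@le_trans _ _ (\sum_(i < l.-1) \1_(misses H (i.+1%:R / Q)) w)).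
    rewrite (eq_bigr (fun=> 1)) ?sumr_const ?card_ord// => i _.
    rewrite indicE mem_set// => hi.
    have : (l <= i.+1)%N by apply: lmin; apply/asboolP.
    by have := ltn_ord i; lia.
  by rewrite lerDl; apply: sumr_ge0 => i _; rewrite indicE.
move=> /(ler_wpM2l (ltW (mulr_gt0 (ltr0n R 2) Qi))).
have -> : (l.-1)%:R = l%:R - 1 :> R by rewrite -subn1 natrB.
have := vH _ pH; move: h1 h2; rewrite -/Q.
by move: (X (f p.1) w) (X (g p.2) w) (\sum_(i < q) _) => x y z; nra.
Qed.

(** At s = l/q^2 the two terms of [Pr_misses] are at most 1/l^2 and 2/(q l) <= 2/l^2, so level [l]
    is missed with conditional probability at most 3/l^2. As the sum of 1/l^2 is at most 2, the
    total is 6 + 2 * 6 + 2 * 3 = 24 over q^2. *)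
Lemma Ex_step_bound (q : nat) (H : {set 'I_n * 'I_n}) : (0 < q)%N -> low_degree H q -> (q ^ 4 <= #|H|)%N ->
  Ex P (fun w => \1_D w * step_bound q H w) <= Pr P D * (24 / (q ^ 2)%:R).
Proof.
move=> q0 low big; have q0' : 0 < q%:R :> R by rewrite ltr0n.
have H0 : (0 < #|H|)%N by rewrite (leq_trans _ big)// expn_gt0 q0.
have mM s := measurable_misses H s.
have mDM s : measurable (D `&` misses H s) by exact: measurableI.
have missle (l : nat) : (0 < l <= q)%N ->
    Pr P (D `&` misses H (l%:R / (q ^ 2)%:R)) <= Pr P D * (3 * (l%:R ^+ 2)^-1).
  move=> /andP[l0 lq]; have l0' : 0 < l%:R :> R by rewrite ltr0n.
  have lq' : l%:R <= q%:R :> R by rewrite ler_nat.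
  apply: (le_trans (Pr_misses _ H0 low)).
    rewrite divr_gt0// ?ltr0n ?expn_gt0 ?q0// ler_pdivrMr ?ltr0n ?expn_gt0 ?q0//.
    by rewrite mul1r ler_nat (leq_trans lq)// leq_pmull.
  apply: ler_wpM2l; first exact: Pr_ge0.
  have eq4 : q%:R ^+ 4 <= #|H|%:R :> R by rewrite -natrX ler_nat.
  move: eq4; set e : R := #|H|%:R => eq4; rewrite natrX.
  have e0 : 0 < e by rewrite ltr0n.
  have -> : 3 * (l%:R ^+ 2)^-1 = (l%:R ^+ 2)^-1 + 2 * (l%:R ^+ 2)^-1 :> R.
    by move: (_^-1) => u; lra.
  have i2 : 0 < q%:R ^- 2 :> R by rewrite invr_gt0 exprn_gt0.
  apply: lerD.
    rewrite lef_pV2 ?posrE ?mulr_gt0 ?exprn_gt0 ?mulr_gt0//.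
    rewrite expr_div_n -exprM mulrCA ler_peMr ?exprn_ge0 ?(ltW l0')//.
    by rewrite ler_pdivlMr ?exprn_gt0// mul1r.
  rewrite -mulrA ler_wpM2l// ler_pdivrMr ?mulr_gt0//.
  rewrite [leRHS]mulrC ler_pdivlMr ?exprn_gt0//.
  rewrite [leRHS]mulrA ler_pdivlMr ?exprn_gt0//.
  apply: (@le_trans _ _ (q%:R ^+ 4 * l%:R)); last by rewrite ler_wpM2r// ltW.
  rewrite (_ : q%:R ^+ 4 * l%:R = q%:R ^+ 3 * (q%:R * l%:R)); last by ring.
  rewrite [leLHS](_ : _ = q%:R ^+ 3 * l%:R ^+ 2); last by ring.
  by rewrite ler_wpM2l ?exprn_ge0 ?(ltW q0')// expr2 ler_wpM2r// ltW.
pose D1 : T -> R := \1_D.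
have bDM s : bounded_meas (fun w => \1_(D `&` misses H s) w : R) by exact: bm_indic.
rewrite (_ : (fun w => _) = fun w => 6 / (q ^ 2)%:R * D1 w
  + (2 / (q ^ 2)%:R * (\sum_(l < q) \1_(D `&` misses H (l.+1%:R / (q ^ 2)%:R)) w)
  + 2 * \1_(D `&` misses H (q%:R / (q ^ 2)%:R)) w)); last first.
  apply/funext => w; rewrite /step_bound !mulrDr -/D1.
  rewrite [in LHS]mulrC; congr (_ + (_ + _)).
    rewrite mulrCA; congr (_ * _); rewrite mulr_sumr.
    by apply: eq_bigr => l _; rewrite indicI.
  by rewrite mulrCA indicI.
have bD1 : bounded_meas D1 by exact: bm_indic.
have bs : bounded_meas (fun w => \sum_(l < q) \1_(D `&` misses H (l.+1%:R / (q ^ 2)%:R)) w : R).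
  by apply: bm_sum => l _.
rewrite ExD; [|exact: bmZ|by apply: bmD; exact: bmZ].
rewrite ExD; [|exact: bmZ|exact: bmZ].
rewrite !ExZ// Ex_sum// Ex_indic//.
have h1 : \sum_(l < q) Ex P \1_(D `&` misses H (l.+1%:R / (q ^ 2)%:R)) <= Pr P D * 6.
  apply: (@le_trans _ _ (\sum_(l < q) Pr P D * (3 * (l.+1%:R ^+ 2)^-1))).
    by apply: ler_sum => l _; rewrite Ex_indic//; apply: missle; rewrite ltn_ord.
  rewrite -!mulr_sumr ler_wpM2l ?Pr_ge0//.
  by have := sum_inv_sqr_le2 R q; lra.
have h2 : Pr P (D `&` misses H (q%:R / (q ^ 2)%:R)) <= Pr P D * (3 * ((q ^ 2)%:R)^-1).
  by rewrite [in leRHS]natrX; apply: missle; rewrite q0 leqnn.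
rewrite Ex_indic//.
have Qi : 0 < (q ^ 2)%:R^-1 :> R by rewrite invr_gt0 ltr0n expn_gt0 q0.
have gen (x y z u : R) : x <= z * 6 -> y <= z * (3 * u) -> 0 < u ->
    6 * u * z + (2 * u * x + 2 * y) <= z * (24 * u).
  by move=> hx hy u0; have := ler_wpM2l (ltW u0) hx; lra.
exact: gen h1 h2 Qi.
Qed.

End second_moment.

(** * The random weights *)

Section uniform_weights.
Context (d : measure_display) (T : measurableType d) (R : realType).
Variables (P : probability T R) (n : nat) (a b c : 'I_n -> 'I_n -> {RV P >-> R}).
Hypothesis indX : mutually_independent (joint_family a b c).
Hypothesis ua : forall i j, uniform01 (a i j).
Hypothesis ub : forall i k, uniform01 (b i k).
Hypothesis uc : forall j k, uniform01 (c j k).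

Notation I := (('I_n * 'I_n) + ('I_n * 'I_n) + ('I_n * 'I_n))%type.
Let X : I -> {RV P >-> R} := joint_family a b c.
Let W w := weight a b c w.
Let fa (i j : 'I_n) : I := inl (inl (i, j)).
Let fb (i k : 'I_n) : I := inl (inr (i, k)).
Let fc (j k : 'I_n) : I := inr (j, k).

Lemma uniform_family x : uniform01 (X x).
Proof. by case: x => [[[i j]|[i k]]|[j k]]; [exact: ua|exact: ub|exact: uc]. Qed.

(** The variables revealed before row [m]: the whole array [c], and the rows of the other two arrays
    up to [m], excluded. *)
Definition past (m : nat) : {set I} :=
  [set x : I | match x with
             | inl (inl p) | inl (inr p) => (p.1 < m)%N
             | inr _ => true
             end]%SET.

Lemma measurable_weight (J : {set I}) i j k : fa i j \in J -> fb i k \in J -> fc j k \in J ->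
  measurable_fun [set: g_sigma_algebraType (rects X J)]
    (fun w : g_sigma_algebraType (rects X J) => W w i j k).
Proof.
move=> aJ bJ cJ; apply: measurable_funD; first apply: measurable_funD.
- exact: (@sigma_measurable_fun _ _ _ _ _ X J _ aJ).
- exact: (@sigma_measurable_fun _ _ _ _ _ X J _ bJ).
- exact: (@sigma_measurable_fun _ _ _ _ _ X J _ cJ).
Qed.

(** The state is decided by finitely many comparisons of weights in rows before [m]. The closure
    lemmas are instantiated explicitly at the generated sigma-algebra, since [T] carries its own as
    well. *)
Lemma sigma_reach M m B C : (m <= M)%N ->
  sigma X (past M) [set w | reach (W w) m B C].
Proof.
elim: m B C => [|m IHm] B C mM.
  rewrite (_ : mkset _ = [set _ : T | B = [set: 'I_n]%SET /\ C = [set: 'I_n]%SET]).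
    exact: (@measurable_set_Prop _ (g_sigma_algebraType (rects X (past M)))).
  by apply/seteqP; split => w /= /reach0.
rewrite (_ : mkset _ = [set w | exists x : 'I_n * 'I_n * 'I_n,
    exists BC : {set 'I_n} * {set 'I_n},
    ((x.1.1 = m :> nat) /\ B = (BC.1 :\ x.1.2)%SET /\ C = (BC.2 :\ x.2)%SET) /\
    (reach (W w) m BC.1 BC.2 /\ argmin_in (W w) x.1.1 BC.1 BC.2 x.1.2 x.2)]); last first.
  by apply/seteqP; split => w /= /reachS.
apply: (@measurable_set_exists _ (g_sigma_algebraType (rects X (past M)))) => -[[i j] k].
apply: (@measurable_set_exists _ (g_sigma_algebraType (rects X (past M)))) => -[B1 C1] /=.
have [im|im] := pselect (i = m :> nat); last first.
  rewrite (_ : mkset _ = set0); first exact: (@measurable0 _ (g_sigma_algebraType (rects X (past M)))).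
  by apply/seteqP; split => // w /= [[]].
apply: (@measurable_set_and _ (g_sigma_algebraType (rects X (past M)))
  (fun=> (i = m :> nat) /\ B = (B1 :\ j)%SET /\ C = (C1 :\ k)%SET)
  (fun w => reach (W w) m B1 C1 /\ argmin_in (W w) i B1 C1 j k)).
  exact: (@measurable_set_Prop _ (g_sigma_algebraType (rects X (past M)))).
apply: (@measurable_set_and _ (g_sigma_algebraType (rects X (past M)))
  (fun w => reach (W w) m B1 C1) (fun w => argmin_in (W w) i B1 C1 j k)).
  exact: IHm (ltnW mM).
rewrite (_ : mkset _ = [set w | (j \in B1 /\ k \in C1) /\
   forall j' k', j' \in B1 -> k' \in C1 -> W w i j k <= W w i j' k']); last first.
  by apply/seteqP; split => w /= [h1 h2]; [|case: h1].
apply: (@measurable_set_and _ (g_sigma_algebraType (rects X (past M)))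
  (fun=> j \in B1 /\ k \in C1)
  (fun w => forall j' k', j' \in B1 -> k' \in C1 -> W w i j k <= W w i j' k')).
  exact: (@measurable_set_Prop _ (g_sigma_algebraType (rects X (past M)))).
apply: (@measurable_set_forall _ (g_sigma_algebraType (rects X (past M)))) => j'.
apply: (@measurable_set_forall _ (g_sigma_algebraType (rects X (past M)))) => k'.
apply: (@measurable_set_imp _ (g_sigma_algebraType (rects X (past M))) (j' \in B1)).
apply: (@measurable_set_imp _ (g_sigma_algebraType (rects X (past M))) (k' \in C1)).
by apply: (@measurable_set_le _ (g_sigma_algebraType (rects X (past M))) R
  (fun w => W w i j k) (fun w => W w i j' k'));
  apply: measurable_weight; rewrite inE//= im.
Qed.

Lemma sigma_below M t (H : {set 'I_n * 'I_n}) :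
  sigma X (past M) [set w | below (fun p => c p.1 p.2) t w = H].
Proof.
rewrite below_eq_rect.
apply: (@fin_bigcap_measurable _ (g_sigma_algebraType (rects X (past M)))) => // p _.
apply: (@sigma_preimage _ _ _ _ _ X (past M) (fc p.1 p.2)); first by rewrite inE.
by case: ifP => _ //; apply: measurableC.
Qed.

(** The almost sure event on which all pathwise bounds are proved: entries in range, and no ties
    within a row. *)
Definition generic (w : T) : Prop :=
  (forall x, 0 <= X x w < 1) /\
  (forall i j k j' k', W w i j k = W w i j' k' -> (j, k) = (j', k')).

(** Isolate a variable occurring on one side of the equation only: [b i k] if the first indices
    agree, [a i j] otherwise. Then [tie_null] applies with all other variables as [J]. *)
Lemma tie_weight_null i j k j' k' : (j, k) != (j', k') ->
  P [set w | W w i j k = W w i j' k'] = 0%E.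
Proof.
move=> ne; have [jj|jj] := eqVneq j j'.
  subst j'; have kk : k != k' by apply: contraNneq ne => ->.
  pose J := (~: [set fb i k])%SET.
  have inJ x : x != fb i k -> x \in J by rewrite !inE.
  pose Y w := b i k' w + c j k' w - c j k w.
  rewrite (_ : mkset _ = [set w | X (fb i k) w = Y w]); last first.
    by apply/seteqP; split => w /=; rewrite /W /weight /Y => h; lra.
  apply: (@tie_null _ _ _ _ _ X indX J); first by rewrite !inE eqxx.
    exact: uniform_family.
  apply: measurable_funB; first apply: measurable_funD.
  - apply: (@sigma_measurable_fun _ _ _ _ _ X J (fb i k')); apply: inJ.
    by apply: contraNneq kk => -[->].
  - by apply: (@sigma_measurable_fun _ _ _ _ _ X J (fc j k')); apply: inJ.
  - by apply: (@sigma_measurable_fun _ _ _ _ _ X J (fc j k)); apply: inJ.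
pose J := (~: [set fa i j])%SET.
have inJ x : x != fa i j -> x \in J by rewrite !inE.
pose Y w := W w i j' k' - b i k w - c j k w.
rewrite (_ : mkset _ = [set w | X (fa i j) w = Y w]); last first.
  by apply/seteqP; split => w /=; rewrite /Y /W /weight => h; lra.
apply: (@tie_null _ _ _ _ _ X indX J); first by rewrite !inE eqxx.
  exact: uniform_family.
apply: measurable_funB; first apply: measurable_funB.
- apply: measurable_weight; apply: inJ => //.
  by apply: contraNneq jj => -[->].
- by apply: (@sigma_measurable_fun _ _ _ _ _ X J (fb i k)); apply: inJ.
- by apply: (@sigma_measurable_fun _ _ _ _ _ X J (fc j k)); apply: inJ.
Qed.

Lemma measurable_weightT i j k : measurable_fun setT (fun w => W w i j k).
Proof. by apply: measurable_funD => //; apply: measurable_funD. Qed.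

Lemma measurable_tie i j k j' k' : measurable [set w | W w i j k = W w i j' k'].
Proof.
rewrite (_ : mkset _ = [set w | W w i j k <= W w i j' k'] `&` [set w | W w i j' k' <= W w i j k]).
  by apply: measurableI; apply: measurable_set_le; exact: measurable_weightT.
apply/seteqP; split => w /=; first by move=> ->.
by move=> [h1 h2]; apply/eqP; rewrite eq_le h1 h2.
Qed.

Lemma measurable_generic : measurable generic.
Proof.
apply: measurable_set_and.
  apply: measurable_set_forall => x.
  rewrite (_ : mkset _ = X x @^-1` `[0, 1[%classic); first exact: measurable_funPTI.
  by apply/seteqP; split => w /=; rewrite in_itv.
apply: measurable_set_forall => i; apply: measurable_set_forall => j.
apply: measurable_set_forall => k; apply: measurable_set_forall => j'.
apply: measurable_set_forall => k'.
have [->|/eqP ne] := eqVneq (j, k) (j', k').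
  by rewrite (_ : mkset _ = setT)//; apply/seteqP; split.
rewrite (_ : mkset _ = ~` [set w | W w i j k = W w i j' k']).
  by apply: measurableC; exact: measurable_tie.
by apply/seteqP; split => w /= h e; [apply: ne; exact: h|].
Qed.

Lemma generic_full : P (~` generic) = 0%E.
Proof.
have mC : measurable (~` generic) by apply: measurableC; exact: measurable_generic.
rewrite (Pr_EFin P mC); congr EFin; apply/eqP; rewrite eq_le Pr_ge0 andbT.
pose A (z : I + 'I_n * (('I_n * 'I_n) * ('I_n * 'I_n))) : set T := match z with
  | inl x => X x @^-1` ~` `[0, 1[%classic
  | inr (i, (p, p')) => [set w | W w i p.1 p.2 = W w i p'.1 p'.2] end.
pose Q (z : I + 'I_n * (('I_n * 'I_n) * ('I_n * 'I_n))) := match z with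
  | inl x => true | inr (i, (p, p')) => p != p' end.
apply: (@le_trans _ _ (\sum_(z | Q z) Pr P (A z))).
  apply: Pr_bigcup_le => //.
    move=> [x|[i [p p']]] _; first by apply: measurable_funPTI; apply: measurableC.
    exact: measurable_tie.
  move=> w /= ng; apply: contrapT => h; apply: ng; split.
    move=> x; apply/negPn/negP => hx; apply: h; exists (inl x) => //=.
    by rewrite in_itv/=; exact/negP.
  move=> i j k j' k' e; apply/eqP/negPn/negP => ne; apply: h.
  by exists (inr (i, ((j, k), (j', k')))).
rewrite big1// => -[x|[i [[j k] [j' k']]]] Qz; rewrite /Pr /A.
  by rewrite uniform01_supp//; exact: uniform_family.
by rewrite tie_weight_null.
Qed.

End uniform_weights.

(** * The expected cost of one greedy step *)

Section greedy_step_cost.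
Context (d : measure_display) (T : measurableType d) (R : realType).
Variables (P : probability T R) (n : nat) (a b c : 'I_n -> 'I_n -> {RV P >-> R}).
Hypothesis indX : mutually_independent (joint_family a b c).
Hypothesis ua : forall i j, uniform01 (a i j).
Hypothesis ub : forall i k, uniform01 (b i k).
Hypothesis uc : forall j k, uniform01 (c j k).

Notation I := (('I_n * 'I_n) + ('I_n * 'I_n) + ('I_n * 'I_n))%type.
Let X : I -> {RV P >-> R} := joint_family a b c.
Let W w := weight a b c w.
Let C0 : 'I_n * 'I_n -> {RV P >-> R} := fun p => c p.1 p.2.
Let fa (i j : 'I_n) : I := inl (inl (i, j)).
Let fb (i k : 'I_n) : I := inl (inr (i, k)).

Let indC : mutually_independent C0.
Proof. by apply: (@mutually_independent_comp _ _ _ _ _ _ X inr) => // x y [->]. Qed.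

Let uC p : uniform01 (C0 p). Proof. exact: uc. Qed.

(** A selection depending only on the state and on the graph of small entries of [c], hence constant
    on each event of the past considered below. The default is the empty graph. *)
Definition sparse_choice (q : nat) (BC : {set 'I_n} * {set 'I_n})
    (G : {set 'I_n * 'I_n}) : {set 'I_n * 'I_n} :=
  odflt finset.set0 [pick H : {set 'I_n * 'I_n} |
    [&& H \subset G :&: finset.setX BC.1 BC.2, low_degree H q & (q ^ 4 <= #|H|)%N]].

Lemma sparse_choiceP q (BC : {set 'I_n} * {set 'I_n}) (G : {set 'I_n * 'I_n}) :
  edge_dense G (q ^ 3) q ->
  (2 * q ^ 3 <= #|BC.1|)%N -> (2 * q ^ 3 <= #|BC.2|)%N ->
  [/\ sparse_choice q BC G \subset G :&: finset.setX BC.1 BC.2,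
      low_degree (sparse_choice q BC G) q & (q ^ 4 <= #|sparse_choice q BC G|)%N].
Proof.
move=> dG hB hC; rewrite /sparse_choice; case: pickP => [H /and3P[]//|none].
have [H [HG low big]] := low_degree_subgraph dG hB hC.
by have := none H; rewrite HG low (_ : (q ^ 4 = q * q ^ 3)%N) ?big// -expnS.
Qed.

(** The past is split by the state and the graph of small entries of [c]; on each good piece
    [Ex_step_bound] applies to the selected subgraph. This costs 24/q^2, and the sparse graphs, of
    total probability at most 1/q^2, cost at most 3 each. *)
Lemma step_cost (i : 'I_n) (q : nat) : (306 <= q)%N -> (2 * q ^ 3 <= n - i)%N ->
  (n <= (2 * q.+1 ^ 3) ^ 4)%N ->
  exists G : T -> R, [/\ bounded_meas G, (forall w, 0 <= G w),
    Ex P G <= 27 / (q ^ 2)%:R &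
    forall w B C j k, generic a b c w -> reach (W w) i B C ->
      argmin_in (W w) i B C j k -> W w i j k <= G w].
Proof.
move=> q306 qi nq; have q0 : (0 < q)%N by lia.
have Q0 : 0 < (q ^ 2)%:R :> R by rewrite ltr0n expn_gt0 q0.
(* A [q ^ 3] by [q ^ 3] rectangle then has 4 q^4 edges on average, four times the required
   density. *)
pose t : R := 4 / (q ^ 2)%:R.
have t01 : 0 <= t <= 1.
  rewrite /t divr_ge0//= ler_pdivrMr// mul1r ler_nat.
  by rewrite (@leq_trans (2 ^ 2))// leq_exp2r//; lia.
pose good (z : ({set 'I_n} * {set 'I_n}) * {set 'I_n * 'I_n}) :=
  [&& edge_dense z.2 (q ^ 3) q, (2 * q ^ 3 <= #|z.1.1|)%N & (2 * q ^ 3 <= #|z.1.2|)%N].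
pose E (H : {set 'I_n * 'I_n}) := [set w | below C0 t w = H].
pose D z := [set w | reach (W w) i z.1.1 z.1.2] `&` E z.2.
pose S z := step_bound X (fa i) (fb i) q (sparse_choice q z.1 z.2).
have mE H : measurable (E H) by exact: measurable_below.
have sD z : sigma X (past n i) (D z).
  apply: (@measurableI _ (g_sigma_algebraType (rects X (past n i)))).
    exact: sigma_reach.
  exact: sigma_below.
have mD z : measurable (D z) by exact: sigma_measurable (sD z).
have bS z : bounded_meas (S z) by exact: bm_step_bound.
have bDS z : bounded_meas (fun w => \1_(D z) w * S z w) by apply: bmM => //; exact: bm_indic.
have bE H : bounded_meas (\1_(E H) : T -> R) by exact: bm_indic.
pose G1 w : R := \sum_(z | good z) \1_(D z) w * S z w.
pose G2 w : R := 3 * \sum_(H | ~~ edge_dense H (q ^ 3) q) \1_(E H) w.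
have bG1 : bounded_meas G1 by apply: bm_sum => z _.
have bG2 : bounded_meas G2 by apply: bmZ; apply: bm_sum => z _.
have G10 w : 0 <= G1 w.
  by apply: sumr_ge0 => z _; rewrite mulr_ge0 ?step_bound_ge0// indicE.
have G20 w : 0 <= G2 w.
  by rewrite mulr_ge0// sumr_ge0// => H _; rewrite indicE.
exists (fun w => G1 w + G2 w); split; [exact: bmD|by move=> w; rewrite addr_ge0| |].
  rewrite ExD// (_ : 27 / (q ^ 2)%:R = 24 / (q ^ 2)%:R + 3 * (q ^ 2)%:R^-1 :> R); last first.
    by move: (_^-1) => x; lra.
  apply: lerD.
    rewrite Ex_sum//.
    apply: (@le_trans _ _ (\sum_(z | good z) Pr P (D z) * (24 / (q ^ 2)%:R))).
      apply: ler_sum => z /and3P[dz z1 z2].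
      have [_ low big] := sparse_choiceP dz z1 z2.
      apply: (@Ex_step_bound _ _ _ _ _ _ indX _ n (fa i) (fb i) (past n i)) => //.
      - exact: uniform_family.
      - by move=> x y [->].
      - by move=> x y [->].
      - by move=> j; rewrite inE /= ltnn.
      - by move=> j; rewrite inE /= ltnn.
    rewrite -mulr_suml -[leRHS]mul1r ler_wpM2r ?divr_ge0//.
    (* Outside ties an outcome determines both the state and the graph, so at most one [D z]
       occurs. *)
    apply: (@sum_Pr_disjoint_le1 _ _ _ P (generic a b c)).
    - exact: measurable_generic.
    - exact: generic_full.
    - by move=> z _.
    - move=> w [[B C] H] [[B' C'] H'] [_ inj] _ _ [/= r1 <-] [/= r2 <-].
      by rewrite (reach_inj inj r1 r2).
  rewrite ExZ; last by apply: bm_sum => H _.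
  rewrite ler_wpM2l// Ex_sum//.
  rewrite (eq_bigr (fun H => Pr P (E H))); last by move=> H _; rewrite Ex_indic.
  apply: le_trans (sparse_union_bound R q306 nq).
  exact: Pr_not_edge_dense.
move=> w B C j k [X01 _] r am.
have X01' x : 0 <= X x w <= 1 by have /andP[-> /ltW ->] := X01 x.
have [jB kC min] := am; have [cB cC] := reach_card r.
set H := below C0 t w.
have [dH|ndH] := boolP (edge_dense H (q ^ 3) q); last first.
  apply: (@le_trans _ _ (G2 w)); last by rewrite lerDr.
  rewrite /G2 (bigD1 H)//= indicE mem_set//=.
  have s0 : 0 <= \sum_(H' | ~~ edge_dense H' (q ^ 3) q && (H' != H)) \1_(E H') w :> R.
    by apply: sumr_ge0 => H' _; rewrite indicE.
  have := X01' (fa i j); have := X01' (fb i k); have := X01' (inr (j, k)).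
  by rewrite /W /weight /X /= => /andP[_ h1] /andP[_ h2] /andP[_ h3]; lra.
apply: (@le_trans _ _ (G1 w)); last by rewrite lerDl.
have gz : good ((B, C), H) by rewrite /good /= dH cB cC qi.
rewrite /G1 (bigD1 ((B, C), H))//= indicE mem_set//= mul1r.
apply: (@le_trans _ _ (S ((B, C), H) w)); last first.
  by rewrite lerDl; apply: sumr_ge0 => z _; rewrite mulr_ge0 ?step_bound_ge0// indicE.
have [sub low big] : [/\ sparse_choice q (B, C) H \subset H :&: finset.setX B C,
      low_degree (sparse_choice q (B, C) H) q & (q ^ 4 <= #|sparse_choice q (B, C) H|)%N].
  by apply: sparse_choiceP => //=; rewrite ?cB ?cC.
apply: le_step_bound => //.
- by rewrite (leq_trans _ big)// expn_gt0 q0.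
- by move=> j'; have /andP[] := X01' (fa i j').
- by move=> k'; have /andP[] := X01' (fb i k').
- move=> [j' k'] /(fintype.subsetP sub); rewrite !inE/= => /andP[ct /andP[jB' kC']].
  apply: (le_trans (min _ _ jB' kC')).
  by rewrite /W /weight /X/= addrC lerD2r.
Qed.

End greedy_step_cost.

(** * Expected costs *)

Section cube_root.
Variable R : realType.

Definition cbrt (k : nat) : R := k%:R `^ (3%:R^-1).

Lemma cbrt_ge0 k : 0 <= cbrt k. Proof. exact: powR_ge0. Qed.

Lemma cbrtK k : cbrt k ^+ 3 = k%:R.
Proof. by rewrite -powR_mulrn ?cbrt_ge0// -powRrM mulVf// powRr1. Qed.

Lemma cbrt0 : cbrt 0 = 0.
Proof. by rewrite /cbrt powR0// invr_neq0. Qed.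

Lemma cbrt_ge1 k : (0 < k)%N -> 1 <= cbrt k.
Proof.
by move=> k0; rewrite -(@ler_pXn2r _ 3)// ?nnegrE ?cbrt_ge0// expr1n cbrtK ler1n.
Qed.

Lemma le_cbrtS k : cbrt k <= cbrt k.+1.
Proof. by rewrite -(@ler_pXn2r _ 3)// ?nnegrE ?cbrt_ge0// !cbrtK ler_nat. Qed.

(* 1 = y^3 - z^3 <= 3 y^2 (y - z) for the consecutive cube roots z <= y *)
Lemma inv_sqr_cbrt_le k : (cbrt k.+1 ^+ 2)^-1 <= 3 * (cbrt k.+1 - cbrt k).
Proof.
have y1 : 1 <= cbrt k.+1 by exact: cbrt_ge1.
have e : cbrt k.+1 ^+ 3 - cbrt k ^+ 3 = 1 by rewrite !cbrtK -natr1 addrC addKr.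
move: (le_cbrtS k) (cbrt_ge0 k) e y1; move: (cbrt k.+1) (cbrt k) => y z zy z0 e y1.
have y0 : 0 < y by lra.
rewrite -[leLHS]mul1r ler_pdivrMr ?exprn_gt0// -[leLHS]e.
have -> : y ^+ 3 - z ^+ 3 = (y - z) * (y ^+ 2 + y * z + z ^+ 2) by ring.
have -> : 3 * (y - z) * y ^+ 2 = (y - z) * (3 * y ^+ 2) by ring.
by rewrite ler_wpM2l ?subr_ge0//; nra.
Qed.

(** Read from the last row, the increments telescope; with [inv_sqr_cbrt_le] this sums the step
    costs r^(-2/3). *)
Lemma sum_cbrt_incr n :
  \sum_(i < n) (cbrt (n - i) - cbrt (n - i).-1) = cbrt n.
Proof.
rewrite (reindex_inj rev_ord_inj)/=.
rewrite (eq_bigr (fun i : 'I_n => cbrt i.+1 - cbrt i)); last first.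
  by move=> i _; rewrite subKn.
by rewrite -(big_mkord xpredT (fun i => cbrt i.+1 - cbrt i)) telescope_sumr// cbrt0 subr0.
Qed.

Lemma sum_geq_nat (n m : nat) : \sum_(i < n) (m <= i)%N%:R = (n - m)%N%:R :> R.
Proof.
elim: n => [|n IHn]; first by rewrite big_ord0.
rewrite big_ord_recr/= IHn; have [mn|nm] := leqP m n.
  by rewrite subSn// natr1.
by rewrite addr0; congr (_%:R); lia.
Qed.

End cube_root.

Section expected_costs.
Context (d : measure_display) (T : measurableType d) (R : realType).
Variables (P : probability T R) (n : nat) (a b c : 'I_n -> 'I_n -> {RV P >-> R}).
Hypothesis indX : mutually_independent (joint_family a b c).
Hypothesis ua : forall i j, uniform01 (a i j).
Hypothesis ub : forall i k, uniform01 (b i k).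
Hypothesis uc : forall j k, uniform01 (c j k).

Notation I := (('I_n * 'I_n) + ('I_n * 'I_n) + ('I_n * 'I_n))%type.
Let X : I -> {RV P >-> R} := joint_family a b c.
Let W w := weight a b c w.

(** Large enough for the trivial bound 3 to suffice while q < 306: then r <= 2 * 306^3, and 9
    r^(2/3) <= 9 r is at most this constant. *)
Definition budget : R := 18 * 306%:R ^+ 3.

(** With r rows left, take [q] maximal such that 2 q^3 <= r and apply [step_cost], or the trivial
    bound 3 if [q] is below 306. *)
Lemma step_cost_budget (i : 'I_n) : n%:R `^ (4%:R^-1) < (n - i)%:R :> R ->
  exists G : T -> R, [/\ bounded_meas G, (forall w, 0 <= G w),
    Ex P G <= budget * (cbrt R (n - i) - cbrt R (n - i).-1) &
    forall w B C j k, generic a b c w -> reach (W w) i B C ->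
      argmin_in (W w) i B C j k -> W w i j k <= G w].
Proof.
have : (0 < n - i)%N by rewrite subn_gt0.
move er : (n - i)%N => [//|r] _ n4r /=.
have ex : exists q, (2 * q ^ 3 <= r.+1)%N by exists 0%N.
have bd q : (2 * q ^ 3 <= r.+1)%N -> (q <= r.+1)%N.
  move=> h; apply: leq_trans h; case: q => // q.
  by rewrite (@leq_trans (q.+1 ^ 3))// ?leq_pmull// -[leqLHS]expn1 leq_pexp2l.
case: (ex_maxnP ex bd) => q qr qmax.
have rq : (r.+1 < 2 * q.+1 ^ 3)%N by rewrite ltnNge; apply/negP => /qmax; rewrite ltnn.
have y1 : 1 <= cbrt R r.+1 by exact: cbrt_ge1.
have yr := cbrtK R r.+1.
have incr := inv_sqr_cbrt_le R r.
have K0 : 0 <= budget by rewrite /budget mulr_ge0// exprn_ge0.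
suff [G [bG G0 EG hG]] : exists G : T -> R, [/\ bounded_meas G, (forall w, 0 <= G w),
    Ex P G <= budget * ((cbrt R r.+1 ^+ 2)^-1 / 3) &
    forall w B C j k, generic a b c w -> reach (W w) i B C ->
      argmin_in (W w) i B C j k -> W w i j k <= G w].
  exists G; split => //; apply: (le_trans EG); apply: ler_wpM2l => //.
  by rewrite ler_pdivrMr// mulrC.
have y2 : 0 < cbrt R r.+1 ^+ 2 by rewrite exprn_gt0//; lra.
have [q306|q306] := leqP 306 q; last first.
  exists (fun=> 3); split=> [|//||w B C j k [X01 _] _ _]; first exact: bm_cst.
  - rewrite Ex_cst mulrA ler_pdivlMr// ler_pdivlMr//.
    apply: (@le_trans _ _ (9 * r.+1%:R)).
      rewrite -yr; nra.
    apply: (@le_trans _ _ (9 * (2 * 306%:R ^+ 3))).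
      rewrite ler_wpM2l// -natrX -natrM ler_nat (leq_trans (ltnW rq))//.
      by rewrite leq_mul2l/= leq_exp2r.
    by rewrite /budget; lra.
  - have := X01 (inl (inl (i, j))); have := X01 (inl (inr (i, k))).
    have := X01 (inr (j, k)).
    by rewrite /W /weight /= => /andP[_ h1] /andP[_ h2] /andP[_ h3]; lra.
(* The hypothesis gives n <= r^4, and maximality of [q] gives r < 2 (q + 1)^3. *)
have nq : (n <= (2 * q.+1 ^ 3) ^ 4)%N.
  rewrite -(ler_nat R); apply: (@le_trans _ _ (r.+1%:R ^+ 4)).
    have -> : n%:R = (n%:R `^ (4%:R^-1)) ^+ 4 :> R.
      by rewrite -powR_mulrn ?powR_ge0// -powRrM mulVf// powRr1.
    by apply: lerXn2r; rewrite ?nnegrE ?powR_ge0// ltW.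
  by rewrite -natrX ler_nat leq_exp2r// ltnW.
have qi : (2 * q ^ 3 <= n - i)%N by rewrite er.
have [G [bG G0 EG hG]] := step_cost indX ua ub uc q306 qi nq.
exists G; split => //; apply: (le_trans EG).
have q0 : (0 < q)%N by lia.
have q0' : 0 < q%:R :> R by rewrite ltr0n.
(* Since q + 1 <= 2 q, the number of rows left is at most 16 q^3 <= 27 q^3. *)
have y3q : cbrt R r.+1 <= 3 * q%:R.
  rewrite -(@ler_pXn2r _ 3)// ?nnegrE ?cbrt_ge0 ?mulr_ge0// cbrtK exprMn.
  rewrite -natrX -natrX -natrM ler_nat (leq_trans (ltnW rq))//.
  apply: (@leq_trans (2 * (2 * q) ^ 3)).
    by rewrite leq_mul2l/= leq_exp2r//; lia.
  by rewrite expnMn mulnA leq_mul2r; apply/orP; right.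
rewrite mulrA ler_pdivlMr// ler_pdivlMr// natrX.
rewrite [leLHS](_ : _ = 81 * cbrt R r.+1 ^+ 2 / q%:R ^+ 2); last by ring.
rewrite ler_pdivrMr ?exprn_gt0//.
have hy : cbrt R r.+1 ^+ 2 <= 9 * q%:R ^+ 2.
  have -> : 9 * q%:R ^+ 2 = (3 * q%:R) ^+ 2 :> R by ring.
  by apply: lerXn2r; rewrite ?nnegrE ?cbrt_ge0 ?mulr_ge0.
have hK : 729 <= budget.
  rewrite /budget; have : 306 <= 306%:R ^+ 3 :> R by rewrite exprS ler_peMr// exprn_ege1// ler1n.
  by lra.
have q2 : 0 <= q%:R ^+ 2 :> R by rewrite exprn_ge0.
apply: (@le_trans _ _ (729 * q%:R ^+ 2)); first by lra.
by rewrite ler_wpM2r.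
Qed.

(** Rows before [m] are charged to the telescoping budget. The other rows number at most n^(1/4) + 1
    <= 2 n^(1/3) and cost at most 3 each, whence the 6. *)
Lemma greedy_upper (m : nat) (sigma tau : T -> 'S_n) : (1 <= n)%N ->
  `|m%:R - (n%:R - n%:R `^ (4%:R^-1))| < 1 :> R ->
  random_perm sigma -> random_perm tau ->
  (forall w, greedy_output (W w) m (sigma w) (tau w)) ->
  ('E_P[fun w => assignment_cost (W w) (sigma w) (tau w)]
     <= ((budget + 6) * n%:R `^ (3%:R^-1))%:E)%E.
Proof.
move=> n1; rewrite ltr_norml => /andP[mlo mhi] msig mtau out.
have generic_le3 w i j k : generic a b c w -> 0 <= W w i j k <= 3.
  move=> [X01 _]; have := X01 (inl (inl (i, j))); have := X01 (inl (inr (i, k))).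
  have := X01 (inr (j, k)).
  by rewrite /W /weight /= => /andP[? ?] /andP[? ?] /andP[? ?]; apply/andP; split; lra.
have /choice[G hG] : forall i : 'I_n, exists G : T -> R, [/\ bounded_meas G, (forall w, 0 <= G w),
    Ex P G <= budget * (cbrt R (n - i) - cbrt R (n - i).-1) + 3 * (m <= i)%N%:R &
    forall w, generic a b c w -> W w i (sigma w i) (tau w i) <= G w].
  move=> i; have [mi|im] := leqP m i.
    exists (fun=> 3); split => //; first exact: bm_cst.
      rewrite Ex_cst mulr1 lerDr mulr_ge0//.
        by rewrite /budget mulr_ge0// exprn_ge0.
      rewrite subr_ge0; have : (0 < n - i)%N by rewrite subn_gt0.
      by case: (n - i)%N => // k _; exact: le_cbrtS.
    by move=> w gw; have /andP[] := generic_le3 w i (sigma w i) (tau w i) gw.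
  have [G [bG G0 EG hG]] : exists G : T -> R, [/\ bounded_meas G, (forall w, 0 <= G w),
      Ex P G <= budget * (cbrt R (n - i) - cbrt R (n - i).-1) &
      forall w B C j k, generic a b c w -> reach (W w) i B C ->
        argmin_in (W w) i B C j k -> W w i j k <= G w].
    (* From i + 1 <= m < n - n^(1/4) + 1 it follows that n^(1/4) < n - i, which holds for either
       rounding of [m]. *)
    apply: step_cost_budget; rewrite natrB; last exact: ltnW.
    have : i.+1%:R <= m%:R :> R by rewrite ler_nat.
    by rewrite -natr1; lra.
  exists G; split => //; first by rewrite mulr0 addr0.
  move=> w gw; have [BC [r am]] := greedy_output_step (out w) im.
  exact: hG gw r am.
have mcost : measurable_fun setT (fun w => assignment_cost (W w) (sigma w) (tau w)).
  (* Splitting over the finitely many values of the two random permutations reduces measurability to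
     fixed permutations. *)
  rewrite (_ : (fun w => _) = fun w => \sum_(s : 'S_n) \sum_(t : 'S_n)
      \1_(sigma @^-1` [set s]) w * \1_(tau @^-1` [set t]) w * assignment_cost (W w) s t).
    apply: measurable_sum => s; apply: measurable_sum => t.
    apply: measurable_funM; first by apply: measurable_funM; exact: measurable_indic.
    by apply: measurable_sum => i; exact: measurable_weightT.
  apply/funext => w; rewrite (bigD1 (sigma w))//= (bigD1 (tau w))//=.
  rewrite !indicE !mem_set//= !mul1r big1 ?addr0; last first.
    by move=> t ne; rewrite [\1_(tau @^-1` _) w]indicE memNset ?mulr0 ?mul0r//= => e; rewrite e eqxx in ne.
  rewrite big1 ?addr0// => s ne; apply: big1 => t _.
  by rewrite [\1_(sigma @^-1` _) w]indicE memNset ?mul0r//= => e; rewrite e eqxx in ne.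
pose Gt w := \sum_(i < n) G i w.
have bGt : bounded_meas Gt by apply: bm_sum => i _; have [] := hG i.
apply: (@le_trans _ _ (Ex P Gt)%:E).
  apply: (expectation_ae_le (measurable_generic a b c) (generic_full indX ua ub uc)) => //.
    by move=> w; apply: sumr_ge0 => i _; have [] := hG i.
  move=> w gw; apply/andP; split.
    by apply: sumr_ge0 => i _; have /andP[] := generic_le3 w i (sigma w i) (tau w i) gw.
  by apply: ler_sum => i _; have [_ _ _] := hG i; apply.
rewrite lee_fin Ex_sum; last by move=> i _; have [] := hG i.
apply: (@le_trans _ _ (\sum_(i < n) (budget * (cbrt R (n - i) - cbrt R (n - i).-1) + 3 * (m <= i)%N%:R))).
  by apply: ler_sum => i _; have [] := hG i.
rewrite big_split/= -!mulr_sumr sum_cbrt_incr sum_geq_nat -/(cbrt R n).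
have y1 := cbrt_ge1 R n1.
have n43 : n%:R `^ (4%:R^-1) <= cbrt R n.
  by apply: ler_powR; rewrite ?ler1n// lef_pV2 ?posrE ?ltr0n// ler_nat.
have nm : (n - m)%:R <= n%:R `^ (4%:R^-1) + 1 :> R.
  have [mn|mn] := leqP m n; first by rewrite natrB//; lra.
  have -> : (n - m = 0)%N by apply/eqP; rewrite subn_eq0 ltnW.
  by have := powR_ge0 (n%:R : R) (4%:R^-1); lra.
by rewrite [leRHS]mulrDl lerD2l; lra.
Qed.

(** A row costs at least [x] unless three entries at most [x] meet in it. At x = n^(-2/3)/2 the
    union bound is n^2 x^3 = 1/8, so the expectation is at least n x (7/8) = (7/16) n^(1/3). *)
Lemma min_cost_lower : (1 <= n)%N ->
  ((4^-1 * n%:R `^ (3%:R^-1))%:E <= 'E_P[fun w => min_cost (W w)])%E.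
Proof.
move=> n1; rewrite -/(cbrt R n); have y1 := cbrt_ge1 R n1.
set y := cbrt R n in y1 *; have y0 : 0 < y by lra.
have yn : y ^+ 3 = n%:R by exact: cbrtK.
pose x : R := (2 * y ^+ 2)^-1.
have y2 : 0 < 2 * y ^+ 2 by rewrite mulr_gt0// exprn_gt0.
have x0 : 0 < x by rewrite invr_gt0.
have x1 : x <= 1 by rewrite invf_le1//; nra.
pose K i j k : {set I} := [set inl (inl (i, j)); inl (inr (i, k)); inr (j, k)]%SET.
pose E i j k := rect X (K i j k) (fun=> `]-oo, x]%classic).
have mE i j k : measurable (E i j k) by exact: measurable_rect.
have PE i j k : Pr P (E i j k) = x ^+ 3.
  have sT : sigma X finset.set0 setT by exact: (@measurableT _ (g_sigma_algebraType (rects X finset.set0))).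
  have := @sigma_indep _ _ _ P _ X indX finset.set0 (K i j k) setT (fun=> `]-oo, x]%classic).
  rewrite setTI Pr_setT mul1r => ->//; last by move=> z; rewrite inE.
  rewrite (eq_bigr (fun=> x)); last first.
    by move=> z _; rewrite uniform01_le ?x1 ?(ltW x0)//; exact: uniform_family.
  rewrite prodr_const; congr (_ ^+ _).
  by rewrite /K -finset.setUA cardsU1 cards2 !inE.
(* The bracket is 1 when no event of row [i] occurs and at most 0 otherwise, so [g] bounds every
   assignment cost from below and its expectation is explicit. *)
pose g w : R := \sum_(i < n) x * (1 - \sum_(j < n) \sum_(k < n) \1_(E i j k) w).
have bE i j k : bounded_meas (\1_(E i j k) : T -> R) by exact: bm_indic.
have bEE i : bounded_meas (fun w => \sum_(j < n) \sum_(k < n) \1_(E i j k) w : R).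
  by apply: bm_sum => j _; apply: bm_sum => k _.
have bE1 i : bounded_meas (fun w => 1 - \sum_(j < n) \sum_(k < n) \1_(E i j k) w : R).
  rewrite (_ : (fun w => _) = fun w => 1 + -1 * \sum_(j < n) \sum_(k < n) \1_(E i j k) w).
    by apply: bmD; [exact: bm_cst|exact: bmZ].
  by apply/funext => w; rewrite mulN1r.
have bg : bounded_meas g by apply: bm_sum => i _; exact: bmZ.
have Eg : Ex P g = n%:R * (x * (1 - n%:R * (n%:R * x ^+ 3))).
  rewrite /g Ex_sum; last by move=> i _; exact: bmZ.
  rewrite (eq_bigr (fun=> x * (1 - n%:R * (n%:R * x ^+ 3)))).
    by rewrite sumr_const card_ord [RHS]mulr_natl.
  move=> i _; rewrite ExZ//; congr (_ * _).
  rewrite (_ : (fun w => _) = fun w => 1 + -1 * \sum_(j < n) \sum_(k < n) \1_(E i j k) w); last first.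
    by apply/funext => w; rewrite mulN1r.
  rewrite ExD; [|exact: bm_cst|exact: bmZ].
  rewrite Ex_cst ExZ// mulN1r; congr (1 - _).
  rewrite Ex_sum; last by move=> j _; apply: bm_sum => k _.
  rewrite (eq_bigr (fun=> n%:R * x ^+ 3)).
    by rewrite sumr_const card_ord [RHS]mulr_natl.
  move=> j _; rewrite Ex_sum// (eq_bigr (fun=> x ^+ 3)).
    by rewrite sumr_const card_ord [RHS]mulr_natl.
  by move=> k _; rewrite Ex_indic.
apply: (@le_trans _ _ (Ex P g)%:E).
  rewrite lee_fin Eg -yn.
  have -> : y ^+ 3 * (x * (1 - y ^+ 3 * (y ^+ 3 * x ^+ 3))) = 7 / 16 * y.
    by rewrite /x; field; rewrite gt_eqF.
  by lra.
apply: (@expectation_ae_ge _ _ _ P (generic a b c) _ _ (n%:R * 3)) => //.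
- exact: measurable_generic.
- exact: generic_full.
- have mA s t : measurable_fun setT (fun w => assignment_cost (W w) s t).
    by apply: measurable_sum => i; exact: measurable_weightT.
  rewrite /min_cost; elim: (index_enum _) => [|st s IHs].
    by under eq_fun do rewrite big_nil; exact: mA.
  by under eq_fun do rewrite big_cons; apply: measurable_minr.
move=> w [X01 _].
have W3 i j k : W w i j k <= 3.
  have := X01 (inl (inl (i, j))); have := X01 (inl (inr (i, k))).
  have := X01 (inr (j, k)).
  by rewrite /W /weight /= => /andP[_ h1] /andP[_ h2] /andP[_ h3]; lra.
have ub3 s t : assignment_cost (W w) s t <= n%:R * 3.
  rewrite mulr_natl -[in leRHS](card_ord n) -sumr_const.
  by apply: ler_sum => i _; exact: W3.
have lbg s t : g w <= assignment_cost (W w) s t.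
  apply: ler_sum => i _.
  have := X01 (inl (inl (i, s i))); have := X01 (inl (inr (i, t i))).
  have := X01 (inr (s i, t i)) => /= /andP[c0 _] /andP[b0 _] /andP[a0 _].
  have E0 j k : 0 <= \1_(E i j k) w :> R by rewrite indicE.
  have S0 : 0 <= \sum_(j < n) \sum_(k < n) \1_(E i j k) w :> R.
    by apply: sumr_ge0 => j _; apply: sumr_ge0 => k _.
  have [xW|Wx] := leP x (W w i (s i) (t i)).
    by apply: le_trans xW; rewrite ger_pMr// gerBl.
  (* The entries are nonnegative with sum below [x], so each of them is at most [x]. *)
  have inE' : E i (s i) (t i) w.
    move: Wx; rewrite /W /weight => Wx z.
    rewrite /= in_itv/= => zK; have : z \in K i (s i) (t i) by [].
    rewrite /K !inE => /orP[/orP[]|] /eqP -> /=; lra.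
  apply: (@le_trans _ _ 0); last by rewrite /W /weight !addr_ge0.
  rewrite pmulr_rle0// subr_le0 (bigD1 (s i))//= (bigD1 (t i))//=.
  rewrite [\1_(E i (s i) (t i)) w]indicE mem_set//= -addrA lerDl addr_ge0//.
    by apply: sumr_ge0.
  by apply: sumr_ge0 => j _; apply: sumr_ge0.
rewrite /min_cost; apply/andP; split.
  by apply: (big_ind (fun v => g w <= v)) => // u v gu gv; rewrite le_min gu gv.
by apply: (big_ind (fun v => v <= n%:R * 3)) => // u v gu gv; rewrite ge_min gu.
Qed.

End expected_costs.

Theorem theorem2 (R : realType) :
  exists c1 c2 : R, 0 < c1 /\ 0 < c2 /\
  forall (n : nat) (d : measure_display) (T : measurableType d)
    (P : probability T R) (a b c : 'I_n -> 'I_n -> {RV P >-> R}),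
    (1 <= n)%N ->
    mutually_independent (joint_family a b c) ->
    (forall i j, uniform01 (a i j)) ->
    (forall i k, uniform01 (b i k)) ->
    (forall j k, uniform01 (c j k)) ->
    ((c1 * n%:R `^ (3%:R^-1))%:E
       <= 'E_P[fun w => min_cost (weight a b c w)])%E
    /\
    (forall (m : nat) (sigma tau : T -> 'S_n),
      `|m%:R - (n%:R - n%:R `^ (4%:R^-1))| < 1 :> R ->
      random_perm sigma -> random_perm tau ->
      (forall w, greedy_output (weight a b c w) m (sigma w) (tau w)) ->
      ('E_P[fun w => assignment_cost (weight a b c w) (sigma w) (tau w)]
         <= (c2 * n%:R `^ (3%:R^-1))%:E)%E).

Proof.
exists 4^-1, (budget R + 6); split; first by rewrite invr_gt0.
split.
  by rewrite ltr_wpDl// /budget mulr_ge0// exprn_ge0.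
move=> n d T P a b c n1 indX ua ub uc; split; first exact: min_cost_lower.
by move=> m sigma tau hm msig mtau out; exact: (greedy_upper indX ua ub uc n1 hm).
Qed.
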